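(* Let $\mathbb{H}$ be a separable Hilbert space, $\mathbb{U}$ a Hilbert space, $b>0$, and $0=t_0<t_1<\dots<t_m<t_{m+1}=b$. Let $\{A(t):t\in[0,b]\}$ be a family of linear operators on $\mathbb{H}$ satisfying (R1)-(R4) of the context, with evolution family $U(t,s)$, and let $B:\mathbb{U}\to\mathbb{H}$, $D_k:\mathbb{H}\to\mathbb{H}$, $E_k:\mathbb{U}\to\mathbb{H}$ ($k=1,\dots,m$) be bounded linear operators. Consider the linear impulsive system $$x'(t)=A(t)x(t)+Bu(t),\ t\in[0,b]\setminus\{t_1,\dots,t_m\},\qquad \Delta x(t_k)=D_kx(t_k)+E_kv_k,\ k=1,\dots,m,\qquad x(0)=x_0,$$ with controls $u\in L^2([0,b];\mathbb{U})$ and $v_1,\dots,v_m\in\mathbb{U}$. Let $\mathcal{M}$ be the control operator, and $\Theta_0^{t_m},\Gamma_{t_m}^b,\widetilde\Theta_0^{t_m},\widetilde\Gamma_{t_m}^b$ the operators on $\mathbb{H}$, defined in the context. Then the following statements are equivalent: (a) The system is approximately controllable on $[0,b]$, i.e. $\overline{\operatorname{Im}\mathcal{M}}=\mathbb{H}$. (b) For $\varphi\in\mathbb{H}$, $\mathcal{M}^*\varphi=0$ implies $\varphi=0$. (c) $\Theta_0^{t_m}+\Gamma_{t_m}^b+\widetilde\Theta_0^{t_m}+\widetilde\Gamma_{t_m}^b$ is strictly positive. (d) $\lambda\left(\lambda I+\Theta_0^{t_m}+\Gamma_{t_m}^b+\widetilde\Theta_0^{t_m}+\widetilde\Gamma_{t_m}^b\right)^{-1}$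 converges to the zero operator as $\lambda\to0^+$ in the strong operator topology. (e) $\lambda\left(\lambda I+\Theta_0^{t_m}+\Gamma_{t_m}^b+\widetilde\Theta_0^{t_m}+\widetilde\Gamma_{t_m}^b\right)^{-1}$ converges to the zero operator as $\lambda\to0^+$ in the weak operator topology.
   Context: Assumptions on $\{A(t)\}$: (R1) Each $A(t)$ is closed, with domain $\mathcal{D}(A(t))=\mathcal{D}(A)$ dense in $\mathbb{H}$ and independent of $t$. (R2) For each $t\in[0,b]$ the resolvent $R(\lambda,A(t))$ exists for all $\lambda$ with $\operatorname{Re}\lambda\ge0$, and there is $K>0$ with $\|R(\lambda,A(t))\|\le K/(|\lambda|+1)$. (R3) There are constants $N_0>0$ and $0<\delta\le1$ with $\|(A(t)-A(s))A^{-1}(\tau)\|\le N_0|t-s|^\delta$ for all $t,s,\tau\in[0,b]$. (R4) $R(\lambda,A(t))$, $t\in[0,b]$, is compact for some $\lambda\in\rho(A(t))$. Under these assumptions there is a unique evolution family $U(t,s)$, $0\le s\le t\le b$, generated by $\{A(t)\}$: bounded linear operators on $\mathbb{H}$ with $U(s,s)=I$, $U(t,s)=U(t,r)U(r,s)$ for $s\le r\le t$, $(t,s)\mapsto U(t,s)x$ continuous for each $x$, and $\frac{\partial}{\partial t}U(t,s)=A(t)U(t,s)$ for $s<t$. Impulses: $\Delta x(t_k)=x(t_k^+)-x(t_k^-)$ with $x(t_k^-)=x(t_k)$. Product convention: $\prod_{j=k}^{i}A_j$ with $k\ge i$ denotes the composition $A_kA_{k-1}\cdots A_i$ (decreasing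 indices, left to right); $\prod_{j=k+1}^{m}A_j$ with increasing indices denotes $A_{k+1}A_{k+2}\cdots A_m$; empty products are the identity. The control operator $\mathcal{M}:L^2([0,b];\mathbb{U})\times\mathbb{U}^m\to\mathbb{H}$ is $$\mathcal{M}(u,\{v_k\}_{k=1}^m)=U(b,t_m)\sum_{i=1}^m\prod_{j=m}^{i+1}(I+D_j)U(t_j,t_{j-1})\,(I+D_i)\int_{t_{i-1}}^{t_i}U(t_i,s)Bu(s)\,ds+\int_{t_m}^bU(b,s)Bu(s)\,ds$$ $$\qquad+U(b,t_m)\sum_{i=2}^m\prod_{j=m}^{i}(I+D_j)U(t_j,t_{j-1})\,E_{i-1}v_{i-1}+U(b,t_m)E_mv_m .$$ $\mathcal{M}^*$ is its Hilbert space adjoint. The four non-negative operators on $\mathbb{H}$ (whose sum is $\mathcal{M}\mathcal{M}^*$) are $$\Gamma_{t_m}^b=\int_{t_m}^bU(b,s)BB^*U^*(b,s)\,ds,\qquad \widetilde\Gamma_{t_m}^b=U(b,t_m)E_mE_m^*U^*(b,t_m),$$ $$\Theta_0^{t_m}=U(b,t_m)\sum_{i=1}^m\prod_{j=m}^{i+1}(I+D_j)U(t_j,t_{j-1})\,(I+D_i)\int_{t_{i-1}}^{t_i}U(t_i,s)BB^*U^*(t_i,s)\,ds\,(I+D_i^* )\prod_{k=i+1}^{m}U^*(t_k,t_{k-1})(I+D_k^* )\,U^*(b,t_m),$$ $$\widetilde\Theta_0^{t_m}=U(b,t_m)\sum_{i=2}^m\prod_{j=m}^{i}(I+D_j)U(t_j,t_{j-1})\,E_{i-1}E_{i-1}^*\prod_{k=i}^{m}U^*(t_k,t_{k-1})(I+D_k^*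 )\,U^*(b,t_m).$$ A bounded self-adjoint operator $W$ on $\mathbb{H}$ is strictly positive if $\langle W\varphi,\varphi\rangle>0$ for every $\varphi\ne0$. *)

(* Defs.v *)
From HB Require Import structures.
From mathcomp Require Import all_boot all_order all_algebra.
From mathcomp Require Export complex.
From mathcomp Require Import all_classical all_reals all_analysis.

Set Implicit Arguments.
Unset Strict Implicit.
Unset Printing Implicit Defensive.

Import Order.TTheory GRing.Theory Num.Theory.
Import numFieldNormedType.Exports.

Local Open Scope classical_set_scope.
Local Open Scope ring_scope.
Local Open Scope complex_scope.

(* A complex Hilbert space is a complete normed module over R[i] together with
   an inner product inducing its norm. Forms of type {dot V for conj} are
   linear in their first argument and conjugate-linear in the second. *)
Definition norm_from_dot (R : realType) (V : completeNormedModType R[i])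
    (ip : {dot V for Num.conj}) : Prop :=
  forall x : V, ip x x = `|x| ^+ 2.

Definition separable_space (T : topologicalType) : Prop :=
  exists2 S : set T, countable S & dense S.

Definition bounded_linear (R : realType) (V W : normedModType R[i])
    (T : V -> W) : Prop :=
  linear T /\ exists M : R, forall x, `|T x| <= M%:C * `|x|.

(* Only meaningful when an adjoint vector exists (as it does for bounded T on
   Hilbert spaces); it is then unique. *)
Definition adjoint (R : realType) (V W : completeNormedModType R[i])
    (ipV : {dot V for Num.conj}) (ipW : {dot W for Num.conj})
    (T : V -> W) (y : W) : V :=
  xget 0 [set z | forall x, ipW (T x) y = ipV x z].

(* The values of opfun outside dom are irrelevant. *)
Record linop (R : realType) (V : normedModType R[i]) := Linop {
  dom : set V;
  opfun :> V -> V;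
  dom0 : dom 0;
  dom_linear : forall (k : R[i]) x y, dom x -> dom y -> dom (k *: x + y);
  opfun_linear : forall (k : R[i]) x y, dom x -> dom y ->
    opfun (k *: x + y) = k *: opfun x + opfun y }.

Definition closed_linop (R : realType) (V : normedModType R[i])
    (T : linop V) : Prop :=
  closed [set p : V * V | dom T p.1 /\ p.2 = T p.1].

(* S is the bounded everywhere-defined inverse of T : X -> V. *)
Definition is_inverse (R : realType) (V : normedModType R[i])
    (X : set V) (T S : V -> V) : Prop :=
  [/\ bounded_linear S, forall y, X (S y) /\ T (S y) = y
    & forall x, X x -> S (T x) = x].

Definition invertible (R : realType) (V : normedModType R[i])
    (X : set V) (T : V -> V) : Prop := exists S, is_inverse X T S.

Definition inverse (R : realType) (V : normedModType R[i])
    (X : set V) (T : V -> V) : V -> V :=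
  xget (fun=> 0) [set S | is_inverse X T S].

Definition resolvent_set (R : realType) (V : normedModType R[i])
    (T : linop V) : set R[i] :=
  [set lambda | invertible (dom T) (fun x => lambda *: x - T x)].

Definition resolvent (R : realType) (V : normedModType R[i])
    (lambda : R[i]) (T : linop V) : V -> V :=
  inverse (dom T) (fun x => lambda *: x - T x).

Definition compact_operator (R : realType) (V : normedModType R[i])
    (S : V -> V) : Prop :=
  bounded_linear S /\ precompact (S @` [set x | `|x| <= 1]).

Definition condR1 (R : realType) (V : normedModType R[i]) (b : R)
    (A : R -> linop V) : Prop :=
  (forall t : R, 0 <= t <= b -> closed_linop (A t) /\ dense (dom (A t))) /\
  (forall t s : R, 0 <= t <= b -> 0 <= s <= b -> dom (A t) = dom (A s)).

Definition condR2 (R : realType) (V : normedModType R[i]) (b : R)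
    (A : R -> linop V) : Prop :=
  exists2 K : R, 0 < K &
    forall t : R, 0 <= t <= b -> forall lambda : R[i], 0 <= complex.Re lambda ->
      resolvent_set (A t) lambda /\
      forall x, `|resolvent lambda (A t) x|
                <= K%:C / (`|lambda| + 1) * `|x|.

Definition condR3 (R : realType) (V : normedModType R[i]) (b : R)
    (A : R -> linop V) : Prop :=
  exists N0 delta : R, [/\ 0 < N0, 0 < delta <= 1 &
    forall t s tau : R, 0 <= t <= b -> 0 <= s <= b -> 0 <= tau <= b ->
      let Ainv := inverse (dom (A tau)) (A tau) in
      forall x, `|A t (Ainv x) - A s (Ainv x)|
                <= (N0 * `|t - s| `^ delta)%:C * `|x|].

Definition condR4 (R : realType) (V : normedModType R[i]) (b : R)
    (A : R -> linop V) : Prop :=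
  forall t : R, 0 <= t <= b ->
    exists2 lambda, resolvent_set (A t) lambda &
      compact_operator (resolvent lambda (A t)).

(* The time derivative is strong; at t = b it is one-sided. *)
Definition evolution_family (R : realType) (V : normedModType R[i]) (b : R)
    (A : R -> linop V) (U : R -> R -> V -> V) : Prop :=
  [/\ forall t s : R, 0 <= s -> s <= t -> t <= b -> bounded_linear (U t s),
      forall (s : R) x, 0 <= s -> s <= b -> U s s x = x,
      forall (t r s : R) x, 0 <= s -> s <= r -> r <= t -> t <= b ->
        U t s x = U t r (U r s x),
      forall x, {within [set p : R * R | [/\ 0 <= p.2, p.2 <= p.1 & p.1 <= b]],
        continuous (fun p : R * R => U p.1 p.2 x)}
    & forall (t s : R) x, 0 <= s -> s < t -> t <= b ->
        dom (A t) (U t s x) /\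
        ((r - t)^-1)%:C *: (U r s x - U t s x)
          @[r --> within [set r : R | s <= r <= b] t^'] --> A t (U t s x)].

Definition simple_function (R : realType) (V : normedModType R[i])
    (f : R -> V) : Prop :=
  finite_set (range f) /\ forall v, measurable (f @^-1` [set v]).

(* Only used on bounded intervals X, so the measure
   below is finite. *)
Definition simple_integral (R : realType) (V : normedModType R[i])
    (X : set R) (f : R -> V) : V :=
  \sum_(v \in range f)
    (fine (lebesgue_measure (X `&` f @^-1` [set v])))%:C *: v.

Definition strongly_measurable (R : realType) (V : normedModType R[i])
    (X : set R) (f : R -> V) : Prop :=
  exists2 g : nat -> R -> V, (forall n, simple_function (g n)) &
    forall x, X x -> g n x @[n --> \oo] --> f x.

(* The norm of V takes its values in the nonnegative reals of R[i]. *)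
Definition rnorm (R : realType) (V : normedModType R[i]) (x : V) : R :=
  complex.Re `|x|.

Definition is_bochner_integral (R : realType) (V : normedModType R[i])
    (X : set R) (f : R -> V) (v : V) : Prop :=
  strongly_measurable X f /\
  exists g : nat -> R -> V,
    [/\ forall n, simple_function (g n),
        (\int[lebesgue_measure]_(s in X) (rnorm (f s - g n s))%:E)%E
          @[n --> \oo] --> 0%E
      & simple_integral X (g n) @[n --> \oo] --> v].

Definition bochner_integral (R : realType) (V : normedModType R[i])
    (X : set R) (f : R -> V) : V :=
  xget 0 [set v | is_bochner_integral X f v].

(* Elements of the Hilbert space L^2([0,b]; Y) x Y^m of controls are represented
   by functions; null_control is equality to 0 in that space. *)
Definition L2 (R : realType) (Y : normedModType R[i]) (b : R) : set (R -> Y) :=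
  [set u | strongly_measurable `[0, b] u /\
    (\int[lebesgue_measure]_(s in `[0%R, b]) (rnorm (u s) ^+ 2)%:E < +oo)%E].

Definition control_dot (R : realType) (Y : completeNormedModType R[i])
    (ip : {dot Y for Num.conj}) (b : R) (m : nat)
    (w w' : (R -> Y) * ('I_m -> Y)) : R[i] :=
  bochner_integral `[0, b] (fun s => ip (w.1 s) (w'.1 s) : R[i]^o)
  + \sum_(k < m) ip (w.2 k) (w'.2 k).

Definition null_control (R : realType) (Y : normedModType R[i]) (b : R)
    (m : nat) (w : (R -> Y) * ('I_m -> Y)) : Prop :=
  {ae lebesgue_measure, forall s, s \in `[0, b] -> w.1 s = 0} /\
  forall k, w.2 k = 0.

Definition control_adjoint (R : realType) (V Y : completeNormedModType R[i])
    (ipV : {dot V for Num.conj}) (ipY : {dot Y for Num.conj})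
    (b : R) (m : nat) (T : (R -> Y) * ('I_m -> Y) -> V) (phi : V) :
    (R -> Y) * ('I_m -> Y) :=
  xget (fun=> 0, fun=> 0)
    [set w | L2 b w.1 /\
      forall w', L2 b w'.1 -> ipV (T w') phi = control_dot ipY b w' w].

(* Impulse data are indexed by 1 <= k <= m: ctrl v k is the (k-1)-th entry of v
   for these k, and other indices are never used. *)
Definition ctrl (R : realType) (Y : normedModType R[i]) (m : nat)
    (v : 'I_m -> Y) (k : nat) : Y :=
  if insub k.-1 is Some i then v i else 0.

(* F_k \o F_(k-1) \o ... \o F_i *)
Definition prod_desc (T : Type) (F : nat -> T -> T) (k i : nat) : T -> T :=
  \big[(fun f g => g \o f)/id]_(i <= j < k.+1) F j.

(* F_i \o F_(i+1) \o ... \o F_k *)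
Definition prod_asc (T : Type) (F : nat -> T -> T) (i k : nat) : T -> T :=
  \big[(fun f g => f \o g)/id]_(i <= j < k.+1) F j.

(* (I + D_j) U(t_j, t_(j-1)) *)
Definition jump (R : realType) (V : normedModType R[i]) (t : nat -> R)
    (U : R -> R -> V -> V) (D : nat -> V -> V) (j : nat) (x : V) : V :=
  U (t j) (t j.-1) x + D j (U (t j) (t j.-1) x).

(* U^*(t_k, t_(k-1)) (I + D_k^* ) *)
Definition jump_adj (R : realType) (V : completeNormedModType R[i])
    (ip : {dot V for Num.conj}) (t : nat -> R)
    (U : R -> R -> V -> V) (D : nat -> V -> V) (k : nat) (x : V) : V :=
  adjoint ip ip (U (t k) (t k.-1)) (x + adjoint ip ip (D k) x).

Definition control_operator (R : realType) (V Y : normedModType R[i])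
    (b : R) (m : nat) (t : nat -> R) (U : R -> R -> V -> V) (B : Y -> V)
    (D : nat -> V -> V) (E : nat -> Y -> V)
    (w : (R -> Y) * ('I_m -> Y)) : V :=
  let u := w.1 in let v := ctrl w.2 in
  U b (t m) (\sum_(1 <= i < m.+1)
      prod_desc (jump t U D) m i.+1
        (let z := bochner_integral `[t i.-1, t i] (fun s => U (t i) s (B (u s)))
         in z + D i z))
  + bochner_integral `[t m, b] (fun s => U b s (B (u s)))
  + U b (t m) (\sum_(2 <= i < m.+1)
      prod_desc (jump t U D) m i (E i.-1 (v i.-1)))
  + U b (t m) (E m (v m)).

Definition Gamma (R : realType) (V Y : completeNormedModType R[i])
    (ipV : {dot V for Num.conj}) (ipY : {dot Y for Num.conj})
    (b : R) (m : nat) (t : nat -> R) (U : R -> R -> V -> V) (B : Y -> V)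
    (phi : V) : V :=
  bochner_integral `[t m, b] (fun s =>
    U b s (B (adjoint ipY ipV B (adjoint ipV ipV (U b s) phi)))).

Definition Gamma_tilde (R : realType) (V Y : completeNormedModType R[i])
    (ipV : {dot V for Num.conj}) (ipY : {dot Y for Num.conj})
    (b : R) (m : nat) (t : nat -> R) (U : R -> R -> V -> V)
    (E : nat -> Y -> V) (phi : V) : V :=
  U b (t m) (E m (adjoint ipY ipV (E m) (adjoint ipV ipV (U b (t m)) phi))).

Definition Theta (R : realType) (V Y : completeNormedModType R[i])
    (ipV : {dot V for Num.conj}) (ipY : {dot Y for Num.conj})
    (b : R) (m : nat) (t : nat -> R) (U : R -> R -> V -> V) (B : Y -> V)
    (D : nat -> V -> V) (phi : V) : V :=
  U b (t m) (\sum_(1 <= i < m.+1)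
    prod_desc (jump t U D) m i.+1
      (let y := prod_asc (jump_adj ipV t U D) i.+1 m
                  (adjoint ipV ipV (U b (t m)) phi) in
       let y' := y + adjoint ipV ipV (D i) y in
       let z := bochner_integral `[t i.-1, t i] (fun s =>
         U (t i) s (B (adjoint ipY ipV B (adjoint ipV ipV (U (t i) s) y')))) in
       z + D i z)).

Definition Theta_tilde (R : realType) (V Y : completeNormedModType R[i])
    (ipV : {dot V for Num.conj}) (ipY : {dot Y for Num.conj})
    (b : R) (m : nat) (t : nat -> R) (U : R -> R -> V -> V)
    (D : nat -> V -> V) (E : nat -> Y -> V) (phi : V) : V :=
  U b (t m) (\sum_(2 <= i < m.+1)
    prod_desc (jump t U D) m i
      (E i.-1 (adjoint ipY ipV (E i.-1)
        (prod_asc (jump_adj ipV t U D) i m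
          (adjoint ipV ipV (U b (t m)) phi))))).

Definition gramian (R : realType) (V Y : completeNormedModType R[i])
    (ipV : {dot V for Num.conj}) (ipY : {dot Y for Num.conj})
    (b : R) (m : nat) (t : nat -> R) (U : R -> R -> V -> V) (B : Y -> V)
    (D : nat -> V -> V) (E : nat -> Y -> V) (phi : V) : V :=
  Theta ipV ipY b m t U B D phi + Gamma ipV ipY b m t U B phi
  + Theta_tilde ipV ipY b m t U D E phi + Gamma_tilde ipV ipY b m t U E phi.

Definition approximately_controllable (R : realType)
    (V Y : normedModType R[i]) (b : R) (m : nat)
    (T : (R -> Y) * ('I_m -> Y) -> V) : Prop :=
  closure (T @` [set w | L2 b w.1]) = setT.

(* In R[i], 0 < z means that z is real and positive. *)
Definition strictly_positive (R : realType) (V : completeNormedModType R[i])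
    (ip : {dot V for Num.conj}) (W : V -> V) : Prop :=
  [/\ bounded_linear W, forall x y, ip (W x) y = ip x (W y)
    & forall x, x != 0 -> 0 < ip (W x) x].

(* Makes explicit that (lambda I + W)^-1 exists, so that the default value of
   inverse plays no role in scaled_inverse. *)
Definition shift_invertible (R : realType) (V : normedModType R[i])
    (W : V -> V) : Prop :=
  forall lambda : R, 0 < lambda ->
    invertible setT (fun x => lambda%:C *: x + W x).

Definition scaled_inverse (R : realType) (V : normedModType R[i])
    (W : V -> V) (lambda : R) (phi : V) : V :=
  lambda%:C *: inverse setT (fun x => lambda%:C *: x + W x) phi.

Definition cvg0_strong (R : realType) (V : normedModType R[i])
    (F : R -> V -> V) : Prop :=
  forall phi, F lambda phi @[lambda --> 0^'+] --> (0 : V).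

Definition cvg0_weak (R : realType) (V : completeNormedModType R[i])
    (ip : {dot V for Num.conj}) (F : R -> V -> V) : Prop :=
  forall phi psi,
    (ip (F lambda phi) psi : R[i]^o) @[lambda --> 0^'+] --> (0 : R[i]^o).

(* Main.v *)
Require Import Defs.
From mathcomp Require Import all_boot all_order all_algebra.
From mathcomp Require Import all_classical all_reals all_analysis.
From mathcomp Require Import finmap measurable_realfun ring lra.

Import Order.TTheory GRing.Theory Num.Theory.
Import numFieldNormedType.Exports.

Local Open Scope classical_set_scope.
Local Open Scope ring_scope.
Local Open Scope complex_scope.

Set Implicit Arguments.
Unset Strict Implicit.
Unset Printing Implicit Defensive.

(** Let [M] be the control operator and [W] the Gramian. The five statements say
    in different ways that the range of [M] is dense, and what links them is the
    factorisation of [W] as [M] composed with its adjoint.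

    The adjoint of [M] is explicit: [adjoint_control phi] propagates [phi]
    backwards through the adjoints of the jumps, then through the adjoint of the
    evolution on each interval. Moving every factor of [M] across the inner
    product gives [ip_control_operator], and substituting this control into [M]
    gives [W phi] ([control_operator_adjoint_control]). Hence [ipH (W phi) psi] is
    the inner product of the controls attached to [phi] and [psi]: [W] is
    symmetric, its quadratic form is nonnegative, and this form vanishes at [phi]
    only when [phi] is orthogonal to the range of [M]. Being symmetric and
    everywhere defined, [W] is linear and bounded by the Hellinger-Toeplitz
    argument ([symmetric_bounded_linear]).

    The cycle of implications is then short. If the range of [M] is dense, only 0
    is orthogonal to it; this is injectivity of the adjoint, and it makes the
    quadratic form of [W] positive away from 0. If [W] is strictly positive, its
    range is dense; the operators [lambda (lambda + W)^-1] are contractions that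
    tend to 0 on this range, hence everywhere
    ([strictly_positive_cvg0_strong]). Strong convergence implies weak
    convergence. Finally, a vector [z] orthogonal to the range of [W] satisfies
    [ip z z = ip (lambda (lambda + W)^-1 z) z], so that weak convergence to 0 makes
    the range of [W] dense ([cvg0_weak_dense_range]); that range is contained in
    the range of [M].

    The analytic work lies in the integrals. A strongly continuous family of
    operators has adjoints that are only weakly continuous in time; in a separable
    Hilbert space this still gives strongly measurable functions
    ([pettis_measurability]). Vector-valued integrals are identified by testing
    them against real functionals ([bochner_functional]), which turns every
    identity between them into one between real Lebesgue integrals. Uniform bounds
    on the evolution operators come from [uniform_boundedness]. *)

(** * Norms with real values and bounded linear maps *)

Lemma realcD (R : realType) (x y : R) : (x + y)%:C = x%:C + y%:C.
Proof. exact: (rmorphD (real_complex R)). Qed.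

Lemma realcM (R : realType) (x y : R) : (x * y)%:C = x%:C * y%:C.
Proof. exact: (rmorphM (real_complex R)). Qed.

Section real_norm.
Context {R : realType} {V : normedModType R[i]}.
Implicit Types x y : V.

Lemma rnormE x : `|x| = (rnorm x)%:C.
Proof. by rewrite /rnorm RRe_real// normr_real. Qed.

Lemma rnorm_ge0 x : 0 <= rnorm x.
Proof. by rewrite -ler0c -rnormE. Qed.

Lemma rnorm0 : rnorm (0 : V) = 0.
Proof. by apply: complexI; rewrite -rnormE normr0. Qed.

Lemma rnorm_eq0 x : (rnorm x == 0) = (x == 0).
Proof. by rewrite -(inj_eq (@complexI R)) -rnormE normr_eq0. Qed.

Lemma rnormN x : rnorm (- x) = rnorm x.
Proof. by rewrite /rnorm normrN. Qed.

Lemma rnormB x y : rnorm (x - y) = rnorm (y - x).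
Proof. by rewrite /rnorm distrC. Qed.

Lemma rnormD x y : rnorm (x + y) <= rnorm x + rnorm y.
Proof. by rewrite -lecR realcD -!rnormE ler_normD. Qed.

Lemma rnorm_le_dist x y : rnorm x <= rnorm y + rnorm (x - y).
Proof. by rewrite -{1}(subrK y x) addrC; apply: rnormD. Qed.

Lemma rnorm_dist x y z : rnorm (x - y) <= rnorm (x - z) + rnorm (z - y).
Proof. by have := rnormD (x - z) (z - y); rewrite addrA subrK. Qed.

Lemma rnormZ (k : R[i]) x : rnorm (k *: x) = rnorm (k : R[i]^o) * rnorm x.
Proof. by apply: (@complexI R); rewrite realcM -!rnormE normrZ. Qed.

Lemma rnorm_real (k : R) : rnorm (k%:C : R[i]^o) = `|k|.
Proof.
by rewrite /rnorm normc_def /= expr0n addr0 sqrtr_sqr.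
Qed.

Lemma rnormZr (k : R) x : rnorm (k%:C *: x) = `|k| * rnorm x.
Proof. by rewrite rnormZ rnorm_real. Qed.

Lemma cvg_rnorm {T} {F : set_system T} {FF : Filter F} (f : T -> V) (l : V) :
  f @ F --> l <-> rnorm (f x - l) @[x --> F] --> (0 : R).
Proof.
split.
- move=> /cvgrPdist_lt fl; apply/cvgrPdist_lt => e e0.
  have := fl e%:C; rewrite ltcR => /(_ e0); apply: filterS => x.
  by rewrite rnormE ltcR sub0r normrN ger0_norm ?rnorm_ge0// rnormB.
- move=> /cvgrPdist_lt fl; apply/cvgrPdist_lt => e.
  rewrite ltcE => /andP[/eqP ei e0].
  have -> : e = (complex.Re e)%:C by apply/eqP; rewrite eq_complex /= eqxx ei /=.
  have := fl (complex.Re e) e0; apply: filterS => x.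
  by rewrite rnormE ltcR sub0r normrN ger0_norm ?rnorm_ge0// rnormB.
Qed.

Lemma cvg_rnormP {T} {F : set_system T} {FF : Filter F} (f : T -> V) (l : V) :
  f @ F --> l <-> forall e : R, 0 < e -> \forall x \near F, rnorm (f x - l) < e.
Proof.
rewrite cvg_rnorm; split=> [/cvgrPdist_lt h e e0|h]; last apply/cvgrPdist_lt => e e0.
  by have := h e e0; apply: filterS => x; rewrite sub0r normrN ger0_norm ?rnorm_ge0.
by have := h e e0; apply: filterS => x; rewrite sub0r normrN ger0_norm ?rnorm_ge0.
Qed.

Lemma near_rnorm (x : V) (P : set V) :
  nbhs x P <-> exists2 e : R, 0 < e & forall y, rnorm (y - x) < e -> P y.
Proof.
split.
- move=> /nbhs_ballP[e e0 eP].
  move: e0; rewrite /= ltcE => /andP[/eqP ei e0].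
  have eE : e = (complex.Re e)%:C by apply/eqP; rewrite eq_complex /= eqxx ei /=.
  exists (complex.Re e) => // y xy; apply: eP.
  by rewrite -ball_normE /= eE rnormE ltcR rnormB.
- move=> [e e0 eP]; apply/nbhs_ballP; exists e%:C; first by rewrite /= ltcR.
  by move=> y; rewrite -ball_normE /= rnormE ltcR rnormB => /eP.
Qed.

End real_norm.

Lemma cauchy_rnorm (R : realType) (V : completeNormedModType R[i]) (u : nat -> V) :
  (forall e : R, 0 < e -> exists N, forall n k, (N <= n)%N -> (N <= k)%N ->
     rnorm (u n - u k) < e) -> exists l : V, u n @[n --> \oo] --> l.
Proof.
move=> uC; suff uc : @cauchy V (u @ \oo) by move: uc => /cauchy_cvg /cvg_ex.
apply: cauchy_exP => e; rewrite ltcE => /andP[/eqP ei e0].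
have eE : e = (complex.Re e)%:C by apply/eqP; rewrite eq_complex /= eqxx ei /=.
have [N NP] := uC _ e0; exists (u N), N => //= n /= Nn.
by rewrite -ball_normE /= eE rnormE ltcR NP.
Qed.

Section bounded_linear_theory.
Context {R : realType} {V W : normedModType R[i]}.
Implicit Type T : V -> W.

Lemma bounded_linearP T : bounded_linear T <->
  linear T /\ exists2 M : R, 0 < M & forall x, rnorm (T x) <= M * rnorm x.
Proof.
split=> -[lT].
- move=> [M MP]; split=> //; exists (`|M| + 1); first by rewrite ltr_wpDl.
  move=> x; apply: (@le_trans _ _ (M * rnorm x)).
    by rewrite -lecR realcM -!rnormE.
  by rewrite ler_wpM2r ?rnorm_ge0// (le_trans (ler_norm M))// lerDl.
- move=> [M _ MP]; split=> //; exists M => x.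
  by rewrite !rnormE -realcM lecR.
Qed.

Lemma bounded_linear_lin T : bounded_linear T ->
  forall k x y, T (k *: x + y) = k *: T x + T y.
Proof. by move=> [lT _] k x y; exact: lT. Qed.

Lemma bounded_linear0 T : bounded_linear T -> T 0 = 0.
Proof.
move=> bT; have := bounded_linear_lin bT 1 0 0.
by rewrite scale1r addr0 scale1r -{1}[T 0]addr0 => /addrI.
Qed.

Lemma bounded_linearD T : bounded_linear T -> {morph T : x y / x + y}.
Proof. by move=> bT x y; have := bounded_linear_lin bT 1 x y; rewrite !scale1r. Qed.

Lemma bounded_linearZ T : bounded_linear T -> forall k, {morph T : x / k *: x}.
Proof.
by move=> bT k x; have := bounded_linear_lin bT k x 0; rewrite (bounded_linear0 bT) !addr0.
Qed.

Lemma bounded_linearN T : bounded_linear T -> {morph T : x / - x}.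
Proof. by move=> bT x; rewrite -scaleN1r (bounded_linearZ bT) scaleN1r. Qed.

Lemma bounded_linearB T : bounded_linear T -> {morph T : x y / x - y}.
Proof. by move=> bT x y; rewrite (bounded_linearD bT) (bounded_linearN bT). Qed.

End bounded_linear_theory.

Lemma bounded_linear_add (R : realType) (V W : normedModType R[i])
    (T S : V -> W) :
  bounded_linear T -> bounded_linear S -> bounded_linear (fun x => T x + S x).
Proof.
move=> bT bS; have [lT [M M0 MP]] := (bounded_linearP T).1 bT.
have [lS [N N0 NP]] := (bounded_linearP S).1 bS.
apply/bounded_linearP; split.
  by move=> k x y /=; rewrite lT lS scalerDr !addrA; congr (_ + _); rewrite addrAC.
exists (M + N); first by rewrite addr_gt0.
by move=> x /=; apply: le_trans (rnormD _ _) _; rewrite mulrDl lerD.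
Qed.

Lemma bounded_linear_cvg (R : realType) (V W : normedModType R[i]) (T : V -> W)
    {I} {F : set_system I} {FF : Filter F} (f : I -> V) (l : V) :
  bounded_linear T -> f @ F --> l -> T (f x) @[x --> F] --> T l.
Proof.
move=> bT /cvg_rnormP fl; apply/cvg_rnormP => e e0.
have [_ [M M0 MP]] := (bounded_linearP T).1 bT.
have := fl _ (divr_gt0 e0 M0); apply: filterS => x h.
by rewrite -(bounded_linearB bT) (le_lt_trans (MP _))// mulrC -ltr_pdivlMr.
Qed.

Lemma natSinv_lt (R : realType) (e : R) : 0 < e ->
  exists N, forall n, (N <= n)%N -> n.+1%:R^-1 < e.
Proof.
move=> e0; have [N _ NP] := near_infty_natSinv_lt (PosNum e0).
by exists N => n Nn; exact: NP.
Qed.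

(** * Hilbert space geometry *)

Section dot_theory.
Context {R : realType} {H : completeNormedModType R[i]}.
Variable ip : {dot H for Num.conj}.
Implicit Types x y z : H.

(** The real inner product. It determines the complex one, by [ip_rdotr], and
    keeps the norm estimates among real numbers. *)
Definition rdot x y : R := complex.Re (ip x y).

Lemma ipDl x y z : ip (x + y) z = ip x z + ip y z.
Proof. exact: linearDl. Qed.

Lemma ipDr x y z : ip x (y + z) = ip x y + ip x z.
Proof. exact: linearD. Qed.

Lemma ipZl k x y : ip (k *: x) y = k * ip x y.
Proof. by rewrite linearZl_LR. Qed.

Lemma ipZr k x y : ip x (k *: y) = Num.conj k * ip x y.
Proof. by rewrite linearZr_LR. Qed.

Lemma ip_conj x y : ip y x = Num.conj (ip x y).
Proof. by rewrite hermC expr0 mul1r. Qed.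

Lemma rdotC x y : rdot x y = rdot y x.
Proof. by rewrite /rdot (ip_conj x y); case: (ip x y). Qed.

Lemma rdotDl x y z : rdot (x + y) z = rdot x z + rdot y z.
Proof. by rewrite /rdot ipDl; case: (ip x z); case: (ip y z). Qed.

Lemma rdotDr x y z : rdot x (y + z) = rdot x y + rdot x z.
Proof. by rewrite rdotC rdotDl (rdotC y) (rdotC z). Qed.

Lemma rdotZl (k : R) x y : rdot (k%:C *: x) y = k * rdot x y.
Proof. by rewrite /rdot ipZl; case: (ip x y) => u v /=; rewrite mul0r subr0. Qed.

Lemma rdotZr (k : R) x y : rdot x (k%:C *: y) = k * rdot x y.
Proof. by rewrite rdotC rdotZl rdotC. Qed.

Lemma rdotNl x y : rdot (- x) y = - rdot x y.
Proof.
have -> : - x = (-1 : R)%:C *: x by rewrite rmorphN scaleN1r.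
by rewrite rdotZl mulN1r.
Qed.

Lemma rdotNr x y : rdot x (- y) = - rdot x y.
Proof. by rewrite rdotC rdotNl rdotC. Qed.

Lemma rdotBl x y z : rdot (x - y) z = rdot x z - rdot y z.
Proof. by rewrite rdotDl rdotNl. Qed.

Lemma rdot0l x : rdot 0 x = 0.
Proof. by rewrite -(subrr (0 : H)) rdotBl subrr. Qed.

Lemma rdot0r x : rdot x 0 = 0.
Proof. by rewrite rdotC rdot0l. Qed.

Lemma ip_rdotr x y : ip x y = rdot x y +i* rdot x ('i *: y).
Proof.
by rewrite /rdot ipZr; case: (ip x y) => u v /=; rewrite mul0r mulN1r opprK add0r.
Qed.

Hypothesis ipN : norm_from_dot ip.

Lemma rdotxx x : rdot x x = rnorm x ^+ 2.
Proof.
rewrite /rdot ipN rnormE expr2 -realcM /= expr2 //.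
Qed.

Lemma rdot_inj x y : (forall z, rdot x z = rdot y z) -> x = y.
Proof.
move=> xy; apply/eqP; rewrite -subr_eq0 -rnorm_eq0 -sqrf_eq0 -rdotxx.
by rewrite rdotBl xy subrr.
Qed.

Lemma rnormD_sqr x y :
  rnorm (x + y) ^+ 2 = rnorm x ^+ 2 + 2 * rdot x y + rnorm y ^+ 2.
Proof.
rewrite -!rdotxx rdotDl !rdotDr (rdotC y x); ring.
Qed.

Lemma rnormB_sqr x y :
  rnorm (x - y) ^+ 2 = rnorm x ^+ 2 - 2 * rdot x y + rnorm y ^+ 2.
Proof. rewrite rnormD_sqr rdotNr rnormN; ring. Qed.

Lemma rdot_le x y : rdot x y <= rnorm x * rnorm y.
Proof.
have [->|x0] := eqVneq x 0; first by rewrite rdot0l rnorm0 mul0r.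
have [->|y0] := eqVneq y 0; first by rewrite rdot0r rnorm0 mulr0.
have nx : 0 < rnorm x by rewrite lt_neqAle rnorm_ge0 eq_sym rnorm_eq0 x0.
have ny : 0 < rnorm y by rewrite lt_neqAle rnorm_ge0 eq_sym rnorm_eq0 y0.
(* for vectors of equal norm the inequality is the nonnegativity of the squared
   norm of their difference *)
have := sqr_ge0 (rnorm ((rnorm y)%:C *: x - (rnorm x)%:C *: y)).
rewrite rnormB_sqr rdotZl rdotZr !rnormZr !ger0_norm ?rnorm_ge0// => h.
have : 0 <= (2 * (rnorm x * rnorm y)) * (rnorm x * rnorm y - rdot x y).
  apply: le_trans h _; rewrite le_eqVlt; apply/orP; left; apply/eqP; ring.
by rewrite pmulr_rge0 ?subr_ge0// !mulr_gt0.
Qed.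

Lemma normr_rdot_le x y : `|rdot x y| <= rnorm x * rnorm y.
Proof.
rewrite ler_norml rdot_le andbT lerNl -rdotNr (le_trans (rdot_le _ _))//.
by rewrite rnormN.
Qed.

Lemma rnorm_ip_le x y : rnorm (ip x y : R[i]^o) <= rnorm x * rnorm y.
Proof.
set z : R[i] := ip x y.
have [z0|z0] := eqVneq (z : R[i]^o) 0.
  by rewrite z0 rnorm0 mulr_ge0 ?rnorm_ge0.
have nz : 0 < rnorm (z : R[i]^o) by rewrite lt_neqAle rnorm_ge0 eq_sym rnorm_eq0 z0.
rewrite -(ler_pM2r nz) -expr2.
(* rotating [y] by the phase of [z] makes the inner product real *)
have -> : rnorm (z : R[i]^o) ^+ 2 = rdot x (z *: y).
  rewrite /rdot ipZr -/z; apply: (@complexI R).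
  rewrite expr2 realcM -rnormE -expr2 normCKC.
  by case: (z) => u v /=; rewrite /real_complex_def; congr (_ +i* _); ring.
by apply: le_trans (rdot_le _ _) _; rewrite rnormZ mulrA [leRHS]mulrAC.
Qed.

(** By the parallelogram identity, a minimising sequence for the distance from
    [x] to [S] is a Cauchy sequence; its limit is the foot of the
    perpendicular. *)
Lemma orthogonal_projection (S : set H) x :
  S 0 -> (forall k u v, S u -> S v -> S (k *: u + v)) ->
  exists2 p, closure S p & forall s, S s -> ip (x - p) s = 0.
Proof.
move=> S0 SL.
pose dist := [set rnorm (x - s) | s in S].
have dist_lb : lbound dist 0 by move=> _ [s _ <-]; exact: rnorm_ge0.
have dist_inf : has_inf dist by split; [exists (rnorm (x - 0)), 0|exists 0].
set d := inf dist.
have d_ge0 : 0 <= d by apply: lb_le_inf => //; case: dist_inf.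
have d_le s : S s -> d <= rnorm (x - s).
  by move=> Ss; apply: ge_inf; [case: dist_inf|exists s].
have /choice[s_ sP] (n : nat) : exists s, S s /\ rnorm (x - s) < d + n.+1%:R^-1.
  have [_ [s Ss <-] h] := inf_adherent (ltac:(by rewrite invr_gt0) : 0 < n.+1%:R^-1 :> R) dist_inf.
  by exists s.
have sS n : S (s_ n) by have [] := sP n.
have sd n : rnorm (x - s_ n) < d + n.+1%:R^-1 by have [] := sP n.
have midS u v : S u -> S v -> S ((2^-1 : R)%:C *: (u + v)).
  move=> Su Sv; rewrite -[_ *: _]addr0; apply: (SL) => //.
  by rewrite -[u]scale1r; apply: SL.
have cauchy_s n k : rnorm (s_ n - s_ k) ^+ 2 <=
    4 * (2 * d + 1) * (n.+1%:R^-1 + k.+1%:R^-1).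
  set a := x - s_ n; set c := x - s_ k.
  have -> : s_ n - s_ k = c - a by rewrite /a /c opprB addrCA addrAC subrr add0r.
  (* the midpoint of [s_ n] and [s_ k] belongs to [S] *)
  have mid : d ^+ 2 * 4 <= rnorm (c + a) ^+ 2.
    have -> : rnorm (c + a) = 2 * rnorm (x - (2^-1 : R)%:C *: (s_ n + s_ k)).
      rewrite -{1}(@ger0_norm R 2)// -rnormZr; congr rnorm.
      rewrite scalerBr scalerA -realcM divff// scale1r /a /c.
      have -> : (2 : R)%:C *: x = x + x.
        by rewrite -[in RHS](scale1r x) -scalerDl -(rmorphD (real_complex R)).
      by rewrite opprD addrACA (addrC (- s_ k)).
    have := d_le _ (midS _ _ (sS n) (sS k)); set e := rnorm _ => de.
    rewrite exprMn -natrX mulrC ler_wpM2l ?ler0n//.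
    by rewrite ler_sqr ?nnegrE// rnorm_ge0.
  have pl : rnorm (c - a) ^+ 2 =
      2 * rnorm c ^+ 2 + 2 * rnorm a ^+ 2 - rnorm (c + a) ^+ 2.
    rewrite rnormB_sqr rnormD_sqr; ring.
  have bnd (j : nat) : rnorm (x - s_ j) ^+ 2 <= d ^+ 2 + (2 * d + 1) * j.+1%:R^-1.
    have j0 : 0 < j.+1%:R^-1 :> R by rewrite invr_gt0.
    have j1 : j.+1%:R^-1 <= 1 :> R by rewrite invf_le1// ler1n.
    have := sd j; move: (rnorm_ge0 (x - s_ j)); set e := rnorm _ => e0 ed.
    have h1 : e ^+ 2 <= (d + j.+1%:R^-1) ^+ 2.
      by rewrite ler_sqr ?nnegrE// ?(ltW ed)// addr_ge0// ltW.
    apply: le_trans h1 _; move: (_^-1) j0 j1 => f f0 f1.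
    have ff : f * f <= f by rewrite ler_piMl// ltW.
    nra.
  have := bnd n; have := bnd k; rewrite -/a -/c.
  have n0 : 0 < n.+1%:R^-1 :> R by rewrite invr_gt0.
  have k0 : 0 < k.+1%:R^-1 :> R by rewrite invr_gt0.
  have d1 : 0 <= 2 * d + 1 by lra.
  have := mulr_ge0 d1 (ltW n0); have := mulr_ge0 d1 (ltW k0).
  rewrite pl -mulrA mulrDr.
  move: (_ / n.+1%:R) (_ / k.+1%:R) => f g.
  move: mid; move: (rnorm (c + a) ^+ 2) (rnorm c ^+ 2) (rnorm a ^+ 2) => u v w; lra.
have [p sp] : exists p : H, s_ n @[n --> \oo] --> p.
  apply: cauchy_rnorm => e e0.
  pose C := 4 * (2 * d + 1).
  have C0 : 0 < C by rewrite /C; nra.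
  have [|N NP] := @natSinv_lt R (e ^+ 2 / (C * 2)).
    by rewrite divr_gt0 ?exprn_gt0// mulr_gt0.
  exists N => n k Nn Nk.
  rewrite -(@ltr_sqr R) ?nnegrE ?rnorm_ge0 ?ltW//.
  apply: le_lt_trans (cauchy_s n k) _.
  rewrite -/C mulrC -ltr_pdivlMr//.
  have := NP n Nn; have := NP k Nk; rewrite invfM mulrA.
  move: (n.+1%:R^-1) (k.+1%:R^-1) (e ^+ 2 / C) => f g h; lra.
exists p.
  move=> A /near_rnorm[e e0 eA].
  have /cvg_rnormP/(_ e e0)[N _ NP] := sp.
  by exists (s_ N); split; [exact: sS|apply: eA; exact: (NP N (leqnn N))].
have xp : rnorm (x - p) <= d.
  apply/ler_addgt0Pr => e e0.
  have /cvg_rnormP/(_ (e/2) (divr_gt0 e0 (ltr0n _ 2)))[N _ NP] := sp.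
  have [N' NP'] := natSinv_lt (divr_gt0 e0 (ltr0n _ 2)).
  have /= := NP (maxn N N') (leq_maxl _ _); have := NP' (maxn N N') (leq_maxr _ _).
  have := sd (maxn N N'); have := rnorm_dist x p (s_ (maxn N N')).
  by move: (rnorm (x - p)) (_.+1%:R^-1) (rnorm (x - _)) (rnorm (_ - p)) => r1 r2 r3 r4; lra.
have rort s : S s -> rdot (x - p) s = 0.
  move=> Ss; have [->|s0] := eqVneq s 0; first by rewrite rdot0r.
  have ns : 0 < rnorm s ^+ 2 by rewrite exprn_gt0// lt_neqAle rnorm_ge0 eq_sym rnorm_eq0 s0.
  set r := rdot _ _.
  (* [c] minimises the distance from [x - p] to the real multiples of [s] *)
  pose c := r / rnorm s ^+ 2.
  have dle : d <= rnorm (x - p - c%:C *: s).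
    apply/ler_addgt0Pr => e e0.
    have /cvg_rnormP/(_ e e0)[N _ /(_ N (leqnn N)) /= NP] := sp.
    have Ss' : S (c%:C *: s + s_ N) by exact: SL.
    apply: le_trans (d_le _ Ss') _.
    have -> : x - (c%:C *: s + s_ N) = (x - p - c%:C *: s) - (s_ N - p).
      by rewrite opprB opprD [RHS]addrAC [in RHS](addrA (x - p)) subrK addrA [LHS]addrAC.
    by apply: le_trans (rnormD _ _) _; rewrite rnormN lerD2l ltW.
  have : d ^+ 2 <= rnorm (x - p - c%:C *: s) ^+ 2.
    by rewrite ler_sqr ?nnegrE// rnorm_ge0.
  rewrite rnormB_sqr rdotZr -/r rnormZr exprMn real_normK ?num_real//.
  have -> : c ^+ 2 * rnorm s ^+ 2 = c * r by rewrite expr2 -mulrA {2}/c divfK ?gt_eqF.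
  have xpd : rnorm (x - p) ^+ 2 <= d ^+ 2 by rewrite ler_sqr ?nnegrE// rnorm_ge0.
  move=> h; have {}h : c * r <= 0 by lra.
  have : r ^+ 2 <= 0.
    have : r ^+ 2 / rnorm s ^+ 2 <= 0 by move: h; rewrite /c mulrAC -expr2.
    by rewrite pmulr_lle0 ?invr_gt0.
  by rewrite le_eqVlt ltNge sqr_ge0 orbF sqrf_eq0 => /eqP.
move=> s Ss; rewrite ip_rdotr rort// rort//.
by rewrite -[_ *: _]addr0; exact: SL.
Qed.

Lemma closure_orthogonal (S : set H) z p : (forall s, S s -> ip z s = 0) ->
  closure S p -> ip z p = 0.
Proof.
move=> zS Sp; apply/eqP; rewrite -(rnorm_eq0 (ip z p : R[i]^o)).
rewrite eq_le rnorm_ge0 andbT; apply/ler_addgt0Pr => e e0; rewrite add0r.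
pose N := rnorm z + 1.
have N0 : 0 < N by rewrite /N ltr_wpDl ?rnorm_ge0.
have [s [Ss sp]] := Sp [set y | rnorm (y - p) < e / N] (ltac:(by apply/near_rnorm; exists (e / N) => //; rewrite divr_gt0)).
have -> : ip z p = - ip z (s - p).
  by rewrite ipDr (zS s)// add0r -[- p]scaleN1r ipZr rmorphN1 mulN1r opprK.
rewrite rnormN (le_trans (rnorm_ip_le _ _))//.
apply: le_trans (_ : N * rnorm (s - p) <= _).
  by rewrite ler_wpM2r ?rnorm_ge0// /N lerDl.
by rewrite mulrC -ler_pdivlMr// ltW.
Qed.

Lemma dense_of_orthogonal (S : set H) :
  S 0 -> (forall k u v, S u -> S v -> S (k *: u + v)) ->
  (forall z, (forall s, S s -> ip z s = 0) -> z = 0) -> closure S = setT.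
Proof.
move=> S0 SL Sz; apply/seteqP; split=> // x _.
have [p Sp xp] := orthogonal_projection x S0 SL.
by have /eqP := Sz _ xp; rewrite subr_eq0 => /eqP ->.
Qed.

(** A vector orthogonal to the kernel of [f] represents [f] up to a scalar, because
    the kernel has codimension at most one. *)
Lemma riesz (f : H -> R[i]^o) : bounded_linear f ->
  exists z, forall x, f x = ip x z.
Proof.
move=> bf.
have [f0|/existsNP[x0 /eqP fx0]] := pselect (forall x, f x = 0).
  by exists 0 => x; rewrite f0 linear0.
have S0 : [set x | f x = 0] 0 by rewrite /= bounded_linear0.
have SL k u v : f u = 0 -> f v = 0 -> f (k *: u + v) = 0.
  by move=> fu fv; rewrite (bounded_linear_lin bf) fu fv scaler0 addr0.
have [p Sp xp] := orthogonal_projection x0 S0 SL.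
have fp : f p = 0.
  have [_ [M M0 MP]] := (bounded_linearP f).1 bf.
  apply/eqP; rewrite -rnorm_eq0 eq_le rnorm_ge0 andbT; apply/ler_addgt0Pr => e e0; rewrite add0r.
  have [s [/= Ss sp]] := Sp [set y | rnorm (y - p) < e / M] (ltac:(by apply/near_rnorm; exists (e / M) => //; rewrite divr_gt0)).
  have -> : f p = - f (s - p) by rewrite (bounded_linearB bf) Ss sub0r opprK.
  by rewrite rnormN (le_trans (MP _))// mulrC -ler_pdivlMr// ltW.
set z := x0 - p in xp.
have fz : f z != 0 by rewrite /z (bounded_linearB bf) fp subr0.
have z0 : z != 0 by apply: contraNN fz => /eqP ->; rewrite (bounded_linear0 bf).
have zz : ip z z != 0 by rewrite ipN sqrf_eq0 normr_eq0.
pose w : R[i] := f z / ip z z.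
exists (Num.conj w *: z) => x.
have fE : f (- (f x / f z) *: z + x) = 0.
  rewrite (bounded_linear_lin bf) scaleNr; apply/eqP.
  by rewrite addrC subr_eq0 -[_ *: f z]/(_ * f z) divfK.
have := xp _ fE; rewrite ip_conj => /eqP; rewrite conjC_eq0 => /eqP.
rewrite ipDl ipZl mulNr addrC => /eqP; rewrite subr_eq0 => /eqP h.
rewrite ipZr conjCK h /w; field; exact/andP.
Qed.

End dot_theory.

Lemma adjointE (R : realType) (H W : completeNormedModType R[i])
    (ipH : {dot H for Num.conj}) (ipW : {dot W for Num.conj}) (T : H -> W) :
  norm_from_dot ipH -> norm_from_dot ipW -> bounded_linear T ->
  forall x y, ipW (T x) y = ipH x (adjoint ipH ipW T y).
Proof.
move=> ipHN ipWN bT x y.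
have bf : bounded_linear ((fun x => ipW (T x) y) : H -> R[i]^o).
  have [_ [M M0 MP]] := (bounded_linearP T).1 bT.
  apply/bounded_linearP; split.
    by move=> k u v; rewrite (bounded_linear_lin bT) ipDl ipZl.
  exists (M * (rnorm y + 1)); first by rewrite mulr_gt0// ltr_wpDl ?rnorm_ge0.
  move=> u; apply: le_trans (rnorm_ip_le ipWN _ _) _.
  rewrite mulrAC; apply: ler_pM; rewrite ?rnorm_ge0//.
  by rewrite lerDl.
have [z zP] := riesz ipHN bf.
by rewrite /adjoint; case: xgetP => [w -> /= ->//|/(_ z) []].
Qed.

Lemma rnorm_adjoint_le (R : realType) (H W : completeNormedModType R[i])
    (ipH : {dot H for Num.conj}) (ipW : {dot W for Num.conj}) (T : H -> W) M :
  norm_from_dot ipH -> norm_from_dot ipW -> bounded_linear T ->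
  0 <= M -> (forall x, rnorm (T x) <= M * rnorm x) ->
  forall y, rnorm (adjoint ipH ipW T y) <= M * rnorm y.
Proof.
move=> ipHN ipWN bT M0 MP y; set z := adjoint _ _ _ _.
have [z0|z0] := eqVneq z 0; first by rewrite z0 rnorm0 mulr_ge0 ?rnorm_ge0.
have nz : 0 < rnorm z by rewrite lt_neqAle rnorm_ge0 eq_sym rnorm_eq0 z0.
rewrite -(ler_pM2r nz) -expr2 -(rdotxx ipHN) {1}/rdot -adjointE//.
apply: le_trans (rdot_le ipWN _ _) _.
by rewrite mulrAC ler_wpM2r ?rnorm_ge0.
Qed.

Lemma adjoint_bounded_linear (R : realType) (H W : completeNormedModType R[i])
    (ipH : {dot H for Num.conj}) (ipW : {dot W for Num.conj}) (T : H -> W) :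
  norm_from_dot ipH -> norm_from_dot ipW -> bounded_linear T ->
  bounded_linear (adjoint ipH ipW T).
Proof.
move=> ipHN ipWN bT; have [_ [M M0 MP]] := (bounded_linearP T).1 bT.
apply/bounded_linearP; split.
  move=> k y z; apply: (rdot_inj ipHN) => x; rewrite rdotC [RHS]rdotC /rdot.
  have TE := adjointE ipHN ipWN bT.
  by rewrite -TE 2!ipDr 2!ipZr !TE.
by exists M => // y; apply: rnorm_adjoint_le => //; exact: ltW.
Qed.

(** * Uniform boundedness and symmetric operators *)

(** If the family were unbounded on every ball, one could shrink balls so that
    on the [n]-th one some member exceeds [n] everywhere; the family would then
    be unbounded at the common point of these balls. *)
Lemma uniform_boundedness (R : realType) (V : completeNormedModType R[i])
    (W : normedModType R[i]) (F : set (V -> W)) :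
  (forall T, F T -> bounded_linear T) ->
  (forall x, exists M, forall T, F T -> rnorm (T x) <= M) ->
  exists2 M : R, 0 < M & forall T, F T -> forall x, rnorm (T x) <= M * rnorm x.
Proof.
move=> Fbl Fpt.
have [[c [r [n [r0 crn]]]]|nball] := pselect (exists c r (n : R), 0 < r /\
    forall T, F T -> forall x, rnorm (x - c) <= r -> rnorm (T x) <= n).
  have n0 T : F T -> 0 <= n.
    move=> FT; apply: le_trans (rnorm_ge0 _) (crn T FT c _).
    by rewrite subrr rnorm0 ltW.
  exists (2 * (`|n| + 1) / r).
    by rewrite divr_gt0// mulr_gt0// ltr_wpDl.
  move=> T FT x; have bT := Fbl _ FT; have {}n0 := n0 _ FT.
  have [->|x0] := eqVneq x 0; first by rewrite (bounded_linear0 bT) !rnorm0 mulr0.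
  have nx : 0 < rnorm x by rewrite lt_neqAle rnorm_ge0 eq_sym rnorm_eq0 x0.
  (* a multiple of [x] is the difference of two points of the ball *)
  pose k := r / rnorm x.
  have k0 : 0 < k by rewrite divr_gt0.
  have h1 : rnorm (T (c + k%:C *: x)) <= n.
    apply: crn => //; rewrite addrC addKr rnormZr gtr0_norm//.
    by rewrite /k divfK ?gt_eqF.
  have h2 : rnorm (T c) <= n by apply: crn => //; rewrite subrr rnorm0 ltW.
  have h3 : k * rnorm (T x) <= 2 * n.
    rewrite -{1}(gtr0_norm k0) -rnormZr -(bounded_linearZ bT).
    have -> : k%:C *: x = (c + k%:C *: x) - c by rewrite addrC addKr.
    rewrite (bounded_linearB bT); apply: le_trans (rnormD _ _) _.
    by rewrite rnormN; lra.
  rewrite mulrAC -mulrA -/k -[_ / r]/(_ / r).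
  have -> : 2 * (`|n| + 1) * (rnorm x / r) = 2 * (`|n| + 1) / k.
    by rewrite /k invfM invrK [r^-1 * _]mulrC.
  rewrite ler_pdivlMr// mulrC (le_trans h3)// ger0_norm//; lra.
have step (q : V * R * nat) : exists q' : V * R, 0 < q.1.2 ->
    [/\ 0 < q'.2, q'.2 <= q.1.2 / 2, rnorm (q'.1 - q.1.1) + q'.2 <= q.1.2 &
    forall y, rnorm (y - q'.1) <= q'.2 -> exists2 T, F T & q.2%:R < rnorm (T y)].
  case: q => -[c r] n /=; have [r0|] := ltP 0 r; last by exists (c, r).
  have [T [FT [x [xc nx]]]] : exists T, F T /\ exists x, rnorm (x - c) <= r / 2 /\
      n%:R < rnorm (T x).
    apply: contrapT => h; apply: nball; exists c, (r / 2), n%:R; split.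
      by rewrite divr_gt0.
    move=> T FT x xc; rewrite leNgt; apply/negP => nx; apply: h.
    by exists T; split=> //; exists x.
  have bT := Fbl _ FT; have [_ [M M0 MP]] := (bounded_linearP T).1 bT.
  (* on a ball of radius [d / (2 * M)] the norm of [T] drops by at most [d / 2] *)
  pose d := rnorm (T x) - n%:R; have d0 : 0 < d by rewrite subr_gt0.
  pose r' := Num.min (r / 2) (d / (2 * M)).
  have r'0 : 0 < r' by rewrite lt_min !divr_gt0// mulr_gt0.
  have r'r : r' <= r / 2 by rewrite ge_min lexx.
  have r'd : r' <= d / (2 * M) by rewrite ge_min lexx orbT.
  exists (x, r') => /= _; split=> //; first by move: xc r'r; lra.
  move=> y yx; exists T => //.
  have h : rnorm (T (x - y)) <= d / 2.
    apply: le_trans (MP _) _; rewrite rnormB.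
    apply: le_trans (_ : M * (d / (2 * M)) <= _).
      by rewrite ler_pM2l// (le_trans yx).
    by rewrite invfM mulrC -!mulrA mulVf ?gt_eqF// mulr1.
  have := rnorm_le_dist (T x) (T y); rewrite -(bounded_linearB bT).
  by move: h d0; rewrite /d; lra.
have [f fP] := choice step.
pose s := fix s n := if n is m.+1 then f (s m, m) else (0 : V, 1 : R).
have s0 n : 0 < (s n).2 by elim: n => [|n IH] /=; [exact: ltr01|have [] := fP (s n, n) IH].
have sP n := fP (s n, n) (s0 n).
have shalf n : (s n).2 <= 2^-1 ^+ n.
  elim: n => [|n IH]; first by rewrite expr0.
  have [_ h _ _] := sP n; apply: le_trans h _.
  by rewrite exprSr ler_wpM2r// invr_ge0.
have nested n k : rnorm ((s (n + k)%N).1 - (s n).1) + (s (n + k)%N).2 <= (s n).2.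
  elim: k => [|k IH]; first by rewrite addn0 subrr rnorm0 add0r.
  rewrite addnS; have [_ _ h _] := sP (n + k)%N.
  have := rnorm_dist (s (n + k).+1).1 (s n).1 (s (n + k)%N).1.
  by move: h IH; rewrite /=; lra.
have near_center n k : (n <= k)%N -> rnorm ((s k).1 - (s n).1) <= (s n).2.
  move=> nk; have := nested n (k - n)%N; rewrite subnKC//.
  by have := s0 k; lra.
have [l sl] : exists l : V, (s n).1 @[n --> \oo] --> l.
  apply: cauchy_rnorm => e e0.
  have : (2^-1 : R) ^+ n @[n --> \oo] --> 0.
    by apply: cvg_expr; rewrite ger0_norm ?invr_ge0// invf_lt1// ltr1n.
  move=> /cvgrPdist_lt/(_ (e / 2) (divr_gt0 e0 (ltr0n _ 2)))[N _ /(_ N (leqnn N))].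
  rewrite /= sub0r normrN ger0_norm ?exprn_ge0 ?invr_ge0// => Ne.
  exists N => n k Nn Nk.
  have := near_center _ _ Nn; have := near_center _ _ Nk; have := shalf N.
  have := rnorm_dist (s n).1 (s k).1 (s N).1; rewrite (rnormB (s N).1).
  lra.
have ln n : rnorm (l - (s n).1) <= (s n).2.
  apply/ler_addgt0Pr => e e0.
  have /cvg_rnormP/(_ e e0)[N _ NP] := sl.
  have := NP (maxn n N) (leq_maxr _ _); rewrite /= rnormB => h.
  have := near_center _ _ (leq_maxl n N).
  by have := rnorm_dist l (s n).1 (s (maxn n N)).1; lra.
have [M MP] := Fpt l.
have [_ _ _ /(_ l)] := sP (Num.truncn M).+1.
have := ln (Num.truncn M).+2; rewrite /= => h /(_ h)[T FT].
by rewrite ltNge (le_trans (MP T FT))// ltW// truncnS_gt.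
Qed.

Section symmetric_operators.
Context {R : realType} {H : completeNormedModType R[i]}.
Variable ip : {dot H for Num.conj}.
Hypothesis ipN : norm_from_dot ip.
Variable W : H -> H.

(** Hellinger-Toeplitz: the functionals [ip _ (W y)], for [y] in the unit ball,
    are pointwise bounded because they equal [ip (W _) y]. *)
Lemma symmetric_bounded_linear :
  (forall x y, ip (W x) y = ip x (W y)) -> bounded_linear W.
Proof.
move=> Wsym; apply/bounded_linearP; split.
  move=> k x y; apply: (rdot_inj ipN) => z.
  by rewrite /rdot Wsym 2!ipDl 2!ipZl !Wsym.
pose F : set (H -> R[i]^o) :=
  [set T | exists2 y, rnorm y <= 1 & T = (fun x => ip x (W y))].
have [T [y y1 ->]|x|M M0 MP] := @uniform_boundedness R H R[i]^o F.
- apply/bounded_linearP; split; first by move=> k u v; rewrite ipDl ipZl.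
  exists (rnorm (W y) + 1); first by rewrite ltr_wpDl ?rnorm_ge0.
  move=> u; rewrite mulrC; apply: le_trans (rnorm_ip_le ipN _ _) _.
  by rewrite ler_wpM2l ?rnorm_ge0// lerDl.
- exists (rnorm (W x)) => T [y y1 ->]; rewrite -Wsym.
  apply: le_trans (rnorm_ip_le ipN _ _) _.
  by rewrite ler_piMr ?rnorm_ge0.
have WZ k x : W (k *: x) = k *: W x.
  by apply: (rdot_inj ipN) => z; rewrite /rdot Wsym 2!ipZl Wsym.
exists M => // x; have [->|x0] := eqVneq x 0.
  have -> : W 0 = 0 by rewrite -[X in W X](scale0r (0 : H)) WZ scale0r.
  by rewrite rnorm0 mulr0.
have nx : 0 < rnorm x by rewrite lt_neqAle rnorm_ge0 eq_sym rnorm_eq0 x0.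
set y := ((rnorm x)^-1)%:C *: x.
have y1 : rnorm y <= 1.
  by rewrite rnormZr ger0_norm ?invr_ge0 ?rnorm_ge0// mulVf// gt_eqF.
have Wy : rnorm (W y) = (rnorm x)^-1 * rnorm (W x).
  by rewrite WZ rnormZr ger0_norm// invr_ge0 rnorm_ge0.
have h : rnorm (ip (W y) (W y) : R[i]^o) <= M * rnorm (W y).
  by apply: (MP (fun u => ip u (W y))); exists y.
have {}h : rnorm (W y) <= M.
  have [Wy0|Wy0] := eqVneq (rnorm (W y)) 0; first by rewrite Wy0 ltW.
  have Wyp : 0 < rnorm (W y) by rewrite lt_neqAle rnorm_ge0 eq_sym Wy0.
  rewrite -(ler_pM2r Wyp) -expr2 -(rdotxx ipN) (le_trans _ h)//.
  rewrite rdotxx// ipN rnormE -rmorphXn /= rnorm_real ger0_norm// exprn_ge0//.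
  exact: rnorm_ge0.
by move: h; rewrite Wy mulrC ler_pdivrMr.
Qed.

Hypothesis bW : bounded_linear W.
Hypothesis W_ge0 : forall x, 0 <= rdot ip (W x) x.

Lemma shift_coercive (lambda : R) x : 0 < lambda ->
  lambda * rnorm x <= rnorm (lambda%:C *: x + W x).
Proof.
move=> l0; have [->|x0] := eqVneq x 0; first by rewrite rnorm0 mulr0 rnorm_ge0.
have nx : 0 < rnorm x by rewrite lt_neqAle rnorm_ge0 eq_sym rnorm_eq0 x0.
rewrite -(ler_pM2r nx); apply: le_trans (rdot_le ipN _ _).
by rewrite rdotDl rdotZl rdotxx// -mulrA -expr2 lerDl.
Qed.

Lemma shift_bounded_linear (lambda : R[i]) :
  bounded_linear (fun x => lambda *: x + W x).
Proof.
apply: bounded_linear_add => //; apply/bounded_linearP; split.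
  by move=> k x y; rewrite scalerDr !scalerA mulrC.
exists (rnorm (lambda : R[i]^o) + 1); first by rewrite ltr_wpDl ?rnorm_ge0.
by move=> x; rewrite rnormZ ler_wpM2r ?rnorm_ge0// lerDl.
Qed.

(** Coercivity makes the range both dense (nothing is orthogonal to it) and
    closed (preimages of a Cauchy sequence form a Cauchy sequence). *)
Lemma nonneg_shift_invertible : shift_invertible W.
Proof.
move=> lambda l0; set L := fun x => _.
have bL : bounded_linear L := shift_bounded_linear _.
have Lc x : lambda * rnorm x <= rnorm (L x) by exact: shift_coercive.
have Linj x y : L x = L y -> x = y.
  move=> Lxy; apply/eqP; rewrite -subr_eq0 -rnorm_eq0 eq_le rnorm_ge0 andbT.
  have := Lc (x - y); rewrite (bounded_linearB bL) Lxy subrr rnorm0.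
  by rewrite pmulr_rle0.
have Ldense : closure (range L) = setT.
  apply: (dense_of_orthogonal ipN).
  - by exists 0 => //; exact: bounded_linear0.
  - move=> k _ _ [x _ <-] [y _ <-]; exists (k *: x + y) => //.
    exact: bounded_linear_lin.
  - move=> z zL; have : rdot ip z (L z) = 0.
      by rewrite /rdot zL//; exists z.
    rewrite rdotC rdotDl rdotZl rdotxx// => h.
    apply/eqP; rewrite -rnorm_eq0 -sqrf_eq0 eq_le sqr_ge0 andbT.
    by rewrite -(pmulr_rle0 _ l0); have := W_ge0 z; lra.
have /choice[S LS] y : exists x, L x = y.
  have /choice[x_ xP] (n : nat) : exists x, rnorm (L x - y) < n.+1%:R^-1.
    have : closure (range L) y by rewrite Ldense.
    move=> /(_ [set z | rnorm (z - y) < n.+1%:R^-1])[].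
      by apply/near_rnorm; exists n.+1%:R^-1 => //; rewrite invr_gt0.
    by move=> _ [[x _ <-] h]; exists x.
  have [x xx] : exists x : H, x_ n @[n --> \oo] --> x.
    apply: cauchy_rnorm => e e0.
    have [|N NP] := @natSinv_lt R (lambda * e / 2).
      by rewrite divr_gt0// mulr_gt0.
    exists N => n k Nn Nk; rewrite -(ltr_pM2l l0).
    apply: le_lt_trans (Lc _) _; rewrite (bounded_linearB bL).
    have := rnorm_dist (L (x_ n)) (L (x_ k)) y; rewrite (rnormB y).
    have := NP _ Nn; have := NP _ Nk; have := xP n; have := xP k.
    move: (n.+1%:R^-1) (k.+1%:R^-1) => f g; lra.
  exists x; apply/eqP; rewrite -subr_eq0 -rnorm_eq0 eq_le rnorm_ge0 andbT.
  apply/ler_addgt0Pr => e e0; rewrite add0r.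
  have e2 : 0 < e / 2 by rewrite divr_gt0.
  have Lx : L (x_ n) @[n --> \oo] --> L x.
    exact: bounded_linear_cvg bL xx.
  have /cvg_rnormP/(_ _ e2)[N _ NP] := Lx.
  have [N' NP'] := natSinv_lt e2.
  have /= := NP (maxn N N') (leq_maxl _ _); have := NP' (maxn N N') (leq_maxr _ _).
  have := xP (maxn N N'); have := rnorm_dist (L x) y (L (x_ (maxn N N'))).
  rewrite (rnormB (L x) (L _)); move: (_.+1%:R^-1) => f; lra.
exists S; split.
- apply/bounded_linearP; split.
    by move=> k x y; apply: Linj; rewrite (bounded_linear_lin bL) !LS.
  exists lambda^-1; first by rewrite invr_gt0.
  by move=> x; rewrite mulrC ler_pdivlMr// mulrC -[in leRHS](LS x).
- by move=> y; split=> //; exact: LS.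
- by move=> x _; apply: Linj; rewrite LS.
Qed.

Lemma inverseP (X : set H) (T : H -> H) :
  invertible X T -> is_inverse X T (inverse X T).
Proof. by move=> [S TS]; rewrite /inverse; case: xgetP => [S' -> //|/(_ S)]. Qed.

(** Coercivity with constant [lambda], applied to [(lambda + W)^-1 x]. *)
Lemma scaled_inverse_le (lambda : R) x : 0 < lambda ->
  rnorm (scaled_inverse W lambda x) <= rnorm x.
Proof.
move=> l0; have [_ SP _] := inverseP (nonneg_shift_invertible l0).
rewrite /scaled_inverse rnormZr gtr0_norm//.
by apply: le_trans (shift_coercive _ l0) _; rewrite (SP x).2.
Qed.

End symmetric_operators.

Lemma symmetric_form_real (R : realType) (H : completeNormedModType R[i])
    (ip : {dot H for Num.conj}) (W : H -> H) x :
  (forall y z, ip (W y) z = ip y (W z)) -> ip (W x) x = (rdot ip (W x) x)%:C.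
Proof.
move=> Wsym; have := ip_conj ip (W x) x; rewrite -Wsym /rdot.
case: (ip (W x) x) => a c [] /eqP; rewrite -addr_eq0 -mulr2n mulrn_eq0 /= => /eqP ->.
by [].
Qed.

Section strong_weak.
Context {R : realType} {H : completeNormedModType R[i]}.
Variable ip : {dot H for Num.conj}.
Hypothesis ipN : norm_from_dot ip.
Variable W : H -> H.

(** The scaled inverses are contractions and send [W psi] to
    [lambda (psi - lambda (lambda + W)^-1 psi)], of norm at most
    [2 lambda] times that of [psi]; the range of [W] is dense. *)
Lemma strictly_positive_cvg0_strong :
  strictly_positive ip W -> shift_invertible W /\ cvg0_strong (scaled_inverse W).
Proof.
move=> [bW Wsym Wpos].
have W_gt0 x : x != 0 -> 0 < rdot ip (W x) x.
  by move=> /Wpos; rewrite ltcE => /andP[].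
have W_ge0 x : 0 <= rdot ip (W x) x.
  by have [->|/W_gt0/ltW//] := eqVneq x 0; rewrite rdot0r.
have Winv := nonneg_shift_invertible ipN bW W_ge0; split=> // phi.
have Wdense : closure (range W) = setT.
  apply: (dense_of_orthogonal ipN).
  - by exists 0 => //; exact: bounded_linear0.
  - move=> k _ _ [x _ <-] [y _ <-]; exists (k *: x + y) => //.
    exact: bounded_linear_lin.
  - move=> z zW; apply/eqP; apply: contraT => /W_gt0.
    by rewrite rdotC /rdot zW ?ltxx//; exists z.
apply/cvg_rnormP => e e0.
have [psi Wpsi] : exists psi, rnorm (W psi - phi) < e / 2.
  have : closure (range W) phi by rewrite Wdense.
  move=> /(_ [set z | rnorm (z - phi) < e / 2])[].
    by apply/near_rnorm; exists (e / 2) => //; rewrite divr_gt0.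
  by move=> _ [[psi _ <-] h]; exists psi.
near=> l.
have l0 : 0 < l by near: l; exact: nbhs_right_gt.
have le4 : l < e / (4 * (rnorm psi + 1)).
  near: l; apply: nbhs_right_lt.
  by rewrite divr_gt0// mulr_gt0// ltr_wpDl ?rnorm_ge0.
rewrite subr0.
have [bS SP SK] := inverseP (Winv l l0).
set S := inverse _ _ in bS SP SK.
have FB : {morph scaled_inverse W l : x y / x - y}.
  by move=> x y; rewrite /scaled_inverse -/S (bounded_linearB bS) scalerBr.
have FW : scaled_inverse W l (W psi) =
    l%:C *: psi - l%:C *: scaled_inverse W l psi.
  rewrite -scalerBr /scaled_inverse -/S; congr (_ *: _).
  rewrite -[in LHS](addKr (l%:C *: psi) (W psi)) addrC (bounded_linearB bS).
  by rewrite SK// (bounded_linearZ bS).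
have := rnorm_le_dist (scaled_inverse W l phi) (scaled_inverse W l (W psi)).
rewrite -FB => h; apply: le_lt_trans h _.
have h1 := scaled_inverse_le ipN bW W_ge0 (phi - W psi) l0.
have h2 := scaled_inverse_le ipN bW W_ge0 psi l0.
have h3 : rnorm (scaled_inverse W l (W psi)) <=
    l * rnorm psi + l * rnorm (scaled_inverse W l psi).
  rewrite FW; apply: le_trans (rnormD _ _) _.
  by rewrite rnormN (rnormZr l psi) (rnormZr l (scaled_inverse W l psi)) gtr0_norm.
rewrite rnormB in h1.
have h4 : l * rnorm (scaled_inverse W l psi) <= l * rnorm psi by rewrite ler_pM2l.
have h5 : l * (4 * (rnorm psi + 1)) < e.
  by rewrite -ltr_pdivlMr// mulr_gt0// ltr_wpDl ?rnorm_ge0.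
have h6 : l * (4 * (rnorm psi + 1)) = 4 * (l * rnorm psi) + 4 * l by ring.
by move: h1 h3 h4 h5 Wpsi; rewrite h6; lra.
Unshelve. all: by end_near. Qed.

Lemma cvg0_strong_weak (F : R -> H -> H) : cvg0_strong F -> cvg0_weak ip F.
Proof.
move=> F0 phi psi; apply/cvg_rnormP => e e0.
pose N := rnorm psi + 1.
have N0 : 0 < N by rewrite /N ltr_wpDl ?rnorm_ge0.
have /cvg_rnormP/(_ (e / N) (divr_gt0 e0 N0)) := F0 phi.
apply: filterS => l; rewrite !subr0 => h.
apply: le_lt_trans (rnorm_ip_le ipN _ _) _.
apply: le_lt_trans (_ : rnorm (F l phi) * N < e).
  by rewrite ler_wpM2l ?rnorm_ge0// lerDl.
by rewrite -ltr_pdivlMr.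
Qed.

(** If [z] is orthogonal to the range of [W], then [z] and
    [lambda (lambda + W)^-1 z] differ by an element of that range, so that
    [ip z z] equals [ip (lambda (lambda + W)^-1 z) z], which tends to 0. *)
Lemma cvg0_weak_dense_range : bounded_linear W ->
  shift_invertible W -> cvg0_weak ip (scaled_inverse W) -> closure (range W) = setT.
Proof.
move=> bW Winv F0; apply: (dense_of_orthogonal ipN).
- by exists 0 => //; exact: bounded_linear0.
- move=> k _ _ [x _ <-] [y _ <-]; exists (k *: x + y) => //.
  exact: bounded_linear_lin.
move=> z zW.
have zF l : 0 < l -> ip (scaled_inverse W l z) z = ip z z.
  move=> l0; have [_ SP _] := inverseP (Winv l l0).
  rewrite /scaled_inverse; set S := inverse _ _ in SP *.
  have -> : ip z z = ip (l%:C *: S z + W (S z)) z by rewrite (SP z).2.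
  rewrite ipDl (ip_conj ip z (W (S z))) zW; last by exists (S z).
  by rewrite conjC0 addr0.
apply/eqP; rewrite -rnorm_eq0 -sqrf_eq0 eq_le sqr_ge0 andbT -(rdotxx ipN).
apply/ler_addgt0Pr => e e0; rewrite add0r.
have /cvg_rnormP/(_ e e0) F0e := F0 z z.
near (0 : R)^'+ => l.
have l0 : 0 < l by near: l; exact: nbhs_right_gt.
have : rnorm (ip (scaled_inverse W l z) z - 0 : R[i]^o) < e by near: l; exact: F0e.
rewrite subr0 zF//; move/ltW; apply: le_trans; rewrite /rdot ipN rnormE -rmorphXn.
by rewrite /= rnorm_real ger0_norm// exprn_ge0// rnorm_ge0.
Unshelve. all: by end_near. Qed.

End strong_weak.

(** * Simple and strongly measurable functions *)

Section simple_functions.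
Context {R : realType}.

Lemma simple_preimage (V : normedModType R[i]) (g : R -> V) (S : set V) :
  simple_function g -> measurable (g @^-1` S).
Proof.
move=> [fg mg]; rewrite (_ : _ @^-1` S =
  \bigcup_(v in range g `&` S) g @^-1` [set v]).
  by apply: fin_bigcup_measurable => [|v _]; [exact: finite_setIl|exact: mg].
apply/seteqP; split=> [s /= Ss|s [v [_ Sv] /= -> //]].
by exists (g s) => //; split=> //; exists s.
Qed.

Lemma simple_cst (V : normedModType R[i]) (v : V) : simple_function (fun _ : R => v).
Proof.
split=> [|w].
  by apply: (sub_finite_set _ (finite_set1 v)) => _ [s _ <-].
have [->|vw] := pselect (v = w).
  by rewrite (_ : _ @^-1` _ = setT)//; apply/seteqP; split.
by rewrite (_ : _ @^-1` _ = set0)//; apply/seteqP; split.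
Qed.

Lemma simple_comp (V W : normedModType R[i]) (T : V -> W) (g : R -> V) :
  simple_function g -> simple_function (T \o g).
Proof.
move=> sg; split=> [|w]; last exact: (simple_preimage (T @^-1` [set w]) sg).
have -> : range (T \o g) = T @` range g.
  by rewrite image_comp.
exact: finite_image sg.1.
Qed.

Lemma simple_comp2 (V W Z : normedModType R[i]) (c : V -> W -> Z)
    (g : R -> V) (h : R -> W) :
  simple_function g -> simple_function h ->
  simple_function (fun s => c (g s) (h s)).
Proof.
move=> sg sh; split.
  apply: (sub_finite_set _ (finite_image2 c sg.1 sh.1)).
  by move=> _ [s _ <-]; exists (g s); [exists s|exists (h s) => //; exists s].
move=> z; rewrite (_ : _ @^-1` [set z] = \bigcup_(v in range g)
    (g @^-1` [set v] `&` h @^-1` [set w | c v w = z])).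
  apply: fin_bigcup_measurable => [|v _]; first exact: sg.1.
  by apply: measurableI; exact: simple_preimage.
apply/seteqP; split=> [s /= <-|s [v _ [/= <- //]]].
by exists (g s); [exists s|split].
Qed.

Lemma simple_if (V : normedModType R[i]) (A : set R) (g h : R -> V) :
  measurable A -> simple_function g -> simple_function h ->
  simple_function (fun s => if s \in A then g s else h s).
Proof.
move=> mA sg sh; split.
  have fU : finite_set (range g `|` range h) by rewrite finite_setU; split; [exact: sg.1|exact: sh.1].
  apply: sub_finite_set fU => _ [s _ <-].
  by case: ifP => _; [left|right]; exists s.
move=> v; rewrite (_ : _ @^-1` [set v] =
    (A `&` g @^-1` [set v]) `|` (~` A `&` h @^-1` [set v])).
  by apply: measurableU; apply: measurableI; (try exact: simple_preimage) => //; exact: measurableC.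
apply/seteqP; split=> [s /=|s /= [[As <-]|[As <-]]].
- by case: ifPn => [/set_mem|]; rewrite ?notin_setE => As <-; [left|right].
- by rewrite mem_set.
- by rewrite memNset.
Qed.

Lemma simple_measurable_fun (V : normedModType R[i]) (g : R -> V) (l : V -> R) X :
  simple_function g -> measurable_fun X (l \o g).
Proof.
move=> sg mX Y mY; apply: measurableI => //.
exact: (simple_preimage (l @^-1` Y) sg).
Qed.

End simple_functions.

Section strong_measurability.
Context {R : realType}.
Implicit Types X A : set R.

Lemma strongly_measurableS (V : normedModType R[i]) X A (f : R -> V) :
  X `<=` A -> strongly_measurable A f -> strongly_measurable X f.
Proof. by move=> XA [g sg gf]; exists g => // s /XA; exact: gf. Qed.

Lemma eq_strongly_measurable (V : normedModType R[i]) X (f g : R -> V) :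
  (forall s, X s -> f s = g s) -> strongly_measurable X f -> strongly_measurable X g.
Proof. by move=> fg [h sh hf]; exists h => // s Xs; rewrite -fg//; exact: hf. Qed.

Lemma strongly_measurable_comp (V W : normedModType R[i]) X (T : V -> W) (f : R -> V) :
  (forall (u : nat -> V) x, u n @[n --> \oo] --> x -> T (u n) @[n --> \oo] --> T x) ->
  strongly_measurable X f -> strongly_measurable X (T \o f).
Proof.
move=> cT [g sg gf]; exists (fun n => T \o g n) => [n|s Xs].
  exact: simple_comp.
by apply: (cT (g ^~ s)); exact: gf.
Qed.

Lemma strongly_measurable_comp2 (V W Z : normedModType R[i]) X
    (c : V -> W -> Z) (f : R -> V) (h : R -> W) :
  (forall (u : nat -> V) (v : nat -> W) x y,
     u n @[n --> \oo] --> x -> v n @[n --> \oo] --> y ->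
     c (u n) (v n) @[n --> \oo] --> c x y) ->
  strongly_measurable X f -> strongly_measurable X h ->
  strongly_measurable X (fun s => c (f s) (h s)).
Proof.
move=> cc [g sg gf] [k sk kh]; exists (fun n s => c (g n s) (k n s)) => [n|s Xs].
  exact: simple_comp2.
by apply: (cc (g ^~ s) (k ^~ s)); [exact: gf|exact: kh].
Qed.

Lemma strongly_measurable_if (V : normedModType R[i]) X A (f h : R -> V) :
  measurable A -> strongly_measurable (X `&` A) f -> strongly_measurable (X `\` A) h ->
  strongly_measurable X (fun s => if s \in A then f s else h s).
Proof.
move=> mA [g sg gf] [k sk kh].
exists (fun n s => if s \in A then g n s else k n s) => [n|s Xs].
  exact: simple_if.
case: ifPn => sA; first by apply: gf; split=> //; exact: set_mem.
by apply: kh; split=> //; move: sA; rewrite notin_setE.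
Qed.

Lemma strongly_measurable_fun (V : normedModType R[i]) X (l : V -> R) (f : R -> V) :
  (forall (u : nat -> V) x, u n @[n --> \oo] --> x -> l (u n) @[n --> \oo] --> l x) ->
  strongly_measurable X f -> measurable_fun X (l \o f).
Proof.
move=> cl [g sg gf]; apply: (@measurable_fun_cvg _ _ _ _ (fun n => l \o g n)).
  by move=> n; exact: simple_measurable_fun.
by move=> s Xs; apply: (cl (g ^~ s)); exact: gf.
Qed.

Lemma cvg_rnorm_comp (V : normedModType R[i]) (u : nat -> V) x :
  u n @[n --> \oo] --> x -> rnorm (u n) @[n --> \oo] --> rnorm x.
Proof.
move=> /cvg_rnormP ux; apply/cvgrPdist_lt => e e0.
have := ux _ e0; apply: filterS => n.
have := rnorm_le_dist x (u n); have := rnorm_le_dist (u n) x.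
rewrite (rnormB x) ltr_norml; lra.
Qed.

Lemma strongly_measurable_rnorm (V : normedModType R[i]) X (f : R -> V) :
  strongly_measurable X f -> measurable_fun X (fun s => rnorm (f s)).
Proof. exact: (strongly_measurable_fun (@cvg_rnorm_comp V)). Qed.

Lemma strongly_measurable_cst (V : normedModType R[i]) X (v : V) :
  strongly_measurable X (fun=> v).
Proof. by exists (fun _ _ => v) => [n|s _]; [exact: simple_cst|exact: cvg_cst]. Qed.

Lemma cvgB_seq (V : normedModType R[i]) (u v : nat -> V) x y :
  u n @[n --> \oo] --> x -> v n @[n --> \oo] --> y ->
  u n - v n @[n --> \oo] --> x - y.
Proof. exact: cvgB. Qed.

Lemma cvg_ip (H : completeNormedModType R[i]) (ip : {dot H for Num.conj})
    (u v : nat -> H) x y : norm_from_dot ip ->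
  u n @[n --> \oo] --> x -> v n @[n --> \oo] --> y ->
  (ip (u n) (v n) : R[i]^o) @[n --> \oo] --> (ip x y : R[i]^o).
Proof.
move=> ipN ux vy; apply/cvg_rnorm.
have h0 : rnorm (u n - x) * rnorm (v n) + rnorm x * rnorm (v n - y)
    @[n --> \oo] --> 0 * rnorm y + rnorm x * 0.
  apply: cvgD; apply: cvgM; [|exact: cvg_rnorm_comp|exact: cvg_cst|].
    exact/cvg_rnorm.
  exact/cvg_rnorm.
rewrite mul0r mulr0 addr0 in h0.
apply: (squeeze_cvgr _ (cvg_cst _) h0); apply: nearW => n.
rewrite rnorm_ge0 /=.
have -> : ip (u n) (v n) - ip x y = ip (u n - x) (v n) + ip x (v n - y).
  have N1 a c : ip (- a) c = - ip a c by rewrite -scaleN1r ipZl mulN1r.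
  have N2 a c : ip a (- c) = - ip a c by rewrite -scaleN1r ipZr rmorphN1 mulN1r.
  by rewrite ipDl N1 ipDr N2 [in RHS]addrA subrK.
by apply: le_trans (rnormD _ _) _; rewrite lerD// rnorm_ip_le.
Qed.

(** Comparing the distances from [f s] to two fixed vectors only involves inner
    products with these vectors. Moving to the [n]-th point of a dense sequence
    exactly when this decreases the distance to [f s] therefore yields simple
    functions, and they converge to [f]. *)
Theorem pettis_measurability (H : completeNormedModType R[i])
    (ip : {dot H for Num.conj}) X (f : R -> H) : norm_from_dot ip ->
  separable_space H -> measurable X ->
  (forall y, measurable_fun X (fun s => rdot ip (f s) y)) ->
  strongly_measurable X f.
Proof.
move=> ipN [S cS dS] mX mf.
have [x_ xd] : exists x_ : nat -> H, forall y (e : R), 0 < e ->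
    exists n, rnorm (y - x_ n) < e.
  have [S0|[x_]] := pfcard_geP cS.
    by have [|x [_]] := dS setT _ openT; [exists 0|rewrite S0].
  exists x_ => y e e0.
  have [|x [xy Sx]] := dS (interior [set x | rnorm (x - y) < e]) _ (open_interior _).
    by exists y; apply/near_rnorm; exists e.
  have [n _ xn] := @surj _ _ _ _ x_ _ Sx.
  by exists n; rewrite xn rnormB; exact: (interior_subset xy).
pose p s a : R := rnorm a ^+ 2 - 2 * rdot ip (f s) a.
have p_lt s a c : (p s a < p s c) = (rnorm (f s - a) < rnorm (f s - c)).
  rewrite -[RHS]ltr_sqr ?nnegrE ?rnorm_ge0// !(rnormB_sqr ipN).
  by rewrite -!addrA ltrD2l /p ![_ ^+ 2 - _]addrC.
have mp a : measurable_fun X (fun s => p s a).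
  apply: measurable_funB; first exact: measurable_cst.
  by apply: measurable_funM; [exact: measurable_cst|exact: mf].
pose A (g : R -> H) n := [set s | X s /\ p s (x_ n) < p s (g s)].
have mA g n : simple_function g -> measurable (A g n).
  move=> sg; rewrite (_ : A g n = \bigcup_(v in range g)
     (g @^-1` [set v] `&` (X `&` (fun s => p s (x_ n) < p s v) @^-1` [set true]))).
    apply: fin_bigcup_measurable => [|v _]; first exact: sg.1.
    apply: measurableI; first exact: sg.2.
    by apply: measurable_fun_ltr => //; exact: mp.
  apply/seteqP; split=> [s [Xs ps]|s [v _ [/= <- [Xs ps]]]]; last by split.
  by exists (g s) => //; exists s.
pose h := fix h n := if n is n'.+1 then
  (fun s => if s \in A (h n') n' then x_ n' else h n' s) else (fun _ : R => 0 : H).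
have sh n : simple_function (h n).
  elim: n => [|n IH]; first exact: simple_cst.
  apply: (@simple_if _ _ _ (fun=> x_ n)); [exact: mA|exact: simple_cst|exact: IH].
exists h => // s Xs; apply/cvg_rnormP => e e0.
have hmono n : rnorm (f s - h n.+1 s) <= rnorm (f s - h n s).
  by rewrite /=; case: ifPn => // /set_mem[_]; rewrite p_lt => /ltW.
have hx n : rnorm (f s - h n.+1 s) <= rnorm (f s - x_ n).
  rewrite /=; case: ifPn => //; rewrite notin_setE => nA.
  by rewrite leNgt -p_lt; apply/negP => ps; exact: nA.
have [n xn] := xd (f s) e e0; exists n.+1 => // k /= nk.
rewrite rnormB; apply: le_lt_trans xn; apply: le_trans (hx n).
rewrite -(subnK nk); elim: (k - n.+1)%N => // j IH.
exact: le_trans (hmono _) IH.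
Qed.

End strong_measurability.

(** * The Bochner integral *)

Section bochner.
Context {R : realType}.
Local Notation mu := (@lebesgue_measure R).
Implicit Types X : set R.

Definition bochner_integrable (V : normedModType R[i]) X (f : R -> V) :=
  strongly_measurable X f /\ mu.-integrable X (EFin \o (fun s => rnorm (f s))).

(** Functionals that are linear over the real numbers cover both the real inner
    products with a fixed vector and the real and imaginary parts of complex
    numbers. *)
Definition real_functional (V : normedModType R[i]) (l : V -> R) :=
  [/\ {morph l : x y / x + y}, forall (r : R) x, l (r%:C *: x) = r * l x
    & exists2 C : R, 0 < C & forall x, `|l x| <= C * rnorm x].

Lemma simple_bounded (V : normedModType R[i]) (g : R -> V) :
  simple_function g -> exists M, forall s, rnorm (g s) <= M.
Proof.
move=> sg; exists (\sum_(v <- fset_set (range g)) rnorm v) => s.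
have gs : g s \in fset_set (range g) by rewrite in_fset_set ?mem_set//; exact: sg.1.
rewrite (bigD1_seq (g s)) ?fset_uniq//= lerDl sumr_ge0// => v _.
exact: rnorm_ge0.
Qed.

Lemma simple_strongly_measurable (V : normedModType R[i]) X (g : R -> V) :
  simple_function g -> strongly_measurable X g.
Proof. by move=> sg; exists (fun=> g) => // s _; exact: cvg_cst. Qed.

Lemma integrable_le X (f h : R -> R) : measurable X ->
  measurable_fun X f -> mu.-integrable X (EFin \o h) ->
  (forall s, X s -> `|f s| <= h s) -> mu.-integrable X (EFin \o f).
Proof.
move=> mX mf ih fh; apply: le_integrable ih => //.
  exact/measurable_EFinP.
by move=> s Xs /=; rewrite lee_fin (le_trans (fh _ Xs))// ler_norm.
Qed.

Lemma integrable_cst X (c : R) : measurable X -> (mu X < +oo)%E ->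
  mu.-integrable X (EFin \o (fun=> c)).
Proof.
move=> mX X_fin; apply: measurable_bounded_integrable => //.
exists `|c|; split; first exact: num_real.
by move=> M cM s _; exact: ltW.
Qed.

Lemma integrable_add X (f g : R -> R) : measurable X ->
  mu.-integrable X (EFin \o f) -> mu.-integrable X (EFin \o g) ->
  mu.-integrable X (EFin \o (fun s => f s + g s)).
Proof.
move=> mX jf jg; have -> : EFin \o (fun s => f s + g s) = (EFin \o f) \+ (EFin \o g).
  by apply/funext => s.
by apply: integrableD.
Qed.

Lemma integrable_scale X (c : R) (f : R -> R) : measurable X ->
  mu.-integrable X (EFin \o f) -> mu.-integrable X (EFin \o (fun s => c * f s)).
Proof.
move=> mX jf; have -> : EFin \o (fun s => c * f s) = (fun s => c%:E * (EFin \o f) s)%E.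
  by apply/funext => s.
by apply: integrableZl.
Qed.

Lemma bochner_integrable_le (V : normedModType R[i]) X (f : R -> V) (h : R -> R) :
  measurable X -> strongly_measurable X f -> mu.-integrable X (EFin \o h) ->
  (forall s, X s -> rnorm (f s) <= h s) -> bochner_integrable X f.
Proof.
move=> mX sf ih fh; split=> //; apply: (integrable_le mX _ ih).
  exact: strongly_measurable_rnorm.
by move=> s Xs; rewrite ger0_norm ?rnorm_ge0//; exact: fh.
Qed.

Lemma bochner_integrable_bounded (V : normedModType R[i]) X (f : R -> V) M :
  measurable X -> (mu X < +oo)%E -> strongly_measurable X f ->
  (forall s, X s -> rnorm (f s) <= M) -> bochner_integrable X f.
Proof.
move=> mX X_fin sf fM; apply: (bochner_integrable_le mX sf _ fM).
exact: integrable_cst.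
Qed.

Lemma bochner_integrable_simple (V : normedModType R[i]) X (g : R -> V) :
  measurable X -> (mu X < +oo)%E -> simple_function g -> bochner_integrable X g.
Proof.
move=> mX X_fin sg; have [M gM] := simple_bounded sg.
apply: (@bochner_integrable_bounded _ _ _ M) => //.
exact: simple_strongly_measurable.
Qed.

Lemma bochner_integrableS (V : normedModType R[i]) X Z (f : R -> V) :
  measurable X -> measurable Z -> X `<=` Z ->
  bochner_integrable Z f -> bochner_integrable X f.
Proof.
move=> mX mZ XZ [sf jf]; split; first exact: strongly_measurableS sf.
by apply: integrableS jf.
Qed.

Lemma bochner_integrableB (V : normedModType R[i]) X (f g : R -> V) :
  measurable X -> bochner_integrable X f -> bochner_integrable X g ->
  bochner_integrable X (fun s => f s - g s).
Proof.
move=> mX [sf jf] [sg jg].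
apply: (@bochner_integrable_le _ _ _ (fun s => rnorm (f s) + rnorm (g s))) => //.
- by apply: (strongly_measurable_comp2 (c := fun x y => x - y)) => // u v x y; exact: cvgB_seq.
- exact: integrable_add.
- by move=> s _; rewrite -(rnormN (g s)); exact: rnormD.
Qed.

Section functional.
Variables (V : normedModType R[i]) (l : V -> R).
Hypothesis rl : real_functional l.

Lemma real_functional0 : l 0 = 0.
Proof. by have [_ lZ _] := rl; rewrite -(scale0r (0 : V)) (lZ 0) mul0r. Qed.

Lemma real_functionalB x y : l (x - y) = l x - l y.
Proof.
have [lD lZ _] := rl; rewrite lD; congr (_ + _).
have -> : - y = (-1 : R)%:C *: y by rewrite rmorphN scaleN1r.
by rewrite lZ mulN1r.
Qed.

Lemma real_functional_sum (I : Type) (r : seq I) (F : I -> V) :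
  l (\sum_(i <- r) F i) = \sum_(i <- r) l (F i).
Proof.
by have [lD _ _] := rl; apply: (big_morph l lD); exact: real_functional0.
Qed.

Lemma real_functional_measurable X (f : R -> V) :
  strongly_measurable X f -> measurable_fun X (fun s => l (f s)).
Proof.
apply: strongly_measurable_fun => u x /cvg_rnormP ux.
have [_ _ [C C0 lC]] := rl; apply/cvgrPdist_lt => e e0.
have := ux _ (divr_gt0 e0 C0); apply: filterS => n h.
rewrite distrC -real_functionalB; apply: le_lt_trans (lC _) _.
by rewrite mulrC -ltr_pdivlMr.
Qed.

Lemma real_functional_integrable X (f : R -> V) : measurable X ->
  bochner_integrable X f -> mu.-integrable X (EFin \o (fun s => l (f s))).
Proof.
move=> mX [sf jf]; have [_ _ [C C0 lC]] := rl.
apply: (@integrable_le _ _ (fun s => C * rnorm (f s))) => //.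
  exact: real_functional_measurable.
exact: integrable_scale.
Qed.

(** Writing [l \o g] as a finite combination of indicators of the level sets of
    [g] identifies both sides. *)
Lemma simple_integral_functional X (g : R -> V) :
  measurable X -> (mu X < +oo)%E -> simple_function g ->
  l (simple_integral X g) = \int[mu]_(s in X) l (g s).
Proof.
move=> mX X_fin sg; have [_ lZ _] := rl.
rewrite /simple_integral fsbig_finite; last exact: sg.1.
rewrite real_functional_sum.
set r := finmap.enum_fset _.
have ru : uniq r by exact: fset_uniq.
have gr s : g s \in r by rewrite /r in_fset_set ?mem_set//; exact: sg.1.
have mg v : measurable (g @^-1` [set v]) by exact: sg.2.
have lgE s : (l (g s))%:E = (\sum_(v <- r) (l v * \1_(g @^-1` [set v]) s)%:E)%E.
  rewrite sumEFin (bigD1_seq (g s) (gr s) ru) /= indicE mem_set// mulr1 big1 ?addr0// => v vg.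
  by rewrite indicE memNset ?mulr0//= => gv; move: vg; rewrite gv eqxx.
rewrite /Rintegral; under eq_integral do rewrite lgE.
have iv v : mu.-integrable X (fun s => (l v * \1_(g @^-1` [set v]) s)%:E).
  apply: (@integrable_le _ _ (fun=> `|l v|)) => //.
  - apply: measurable_funM; first exact: measurable_cst.
    exact: measurable_indic.
  - exact: integrable_cst.
  - by move=> s _; rewrite normrM indicE; case: (_ \in _); rewrite ?normr1 ?normr0 ?mulr1 ?mulr0.
rewrite integral_sum//.
have ivE v : (\int[mu]_(s in X) (l v * \1_(g @^-1` [set v]) s)%:E)%E =
    (l v * fine (mu (X `&` g @^-1` [set v])))%:E.
  have fin : mu (X `&` g @^-1` [set v]) \is a fin_num.
    rewrite ge0_fin_numE//; apply: le_lt_trans X_fin.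
    have mXv : measurable (X `&` g @^-1` [set v]) by apply: measurableI.
    by apply: le_measure; [exact/mem_set|exact/mem_set|exact: subIsetl].
  under eq_integral do rewrite EFinM.
  rewrite integralZl//; last first.
    apply: (@integrable_le _ _ (fun=> 1)) => //.
    - exact: integrable_cst.
    - by move=> s _; rewrite indicE; case: (_ \in _); rewrite ?normr1 ?normr0.
  rewrite EFinM fineK//; congr (_ * _)%E.
  by rewrite (integral_indic mu _ (mg v)) 1?setIC.
under [in RHS]eq_bigr do rewrite ivE.
rewrite sumEFin /=; apply: eq_bigr => v _.
by rewrite lZ mulrC.
Qed.

Lemma functional_integral_dist X (f g : R -> V) (C : R) :
  measurable X -> bochner_integrable X f -> bochner_integrable X g ->
  (forall x, `|l x| <= C * rnorm x) ->
  `|\int[mu]_(s in X) l (f s) - \int[mu]_(s in X) l (g s)| <=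
  C * \int[mu]_(s in X) rnorm (f s - g s).
Proof.
move=> mX jf jg lC; have jfg := bochner_integrableB mX jf jg.
have jl := real_functional_integrable mX jfg.
rewrite -RintegralB//; try exact: real_functional_integrable.
have -> : \int[mu]_(s in X) (l (f s) - l (g s)) = \int[mu]_(s in X) l (f s - g s).
  by apply: eq_Rintegral => s _; rewrite real_functionalB.
rewrite -RintegralZl//; last exact: jfg.2.
apply: le_trans (le_normr_Rintegral _ _) _ => //.
apply: le_Rintegral => //; first by have := integrable_norm jl.
exact: (integrable_scale _ _ jfg.2).
Qed.

(** A Bochner integral is characterised by testing against real functionals:
    the two sides differ by at most a multiple of the [L^1] distance from [f] to
    its simple approximations. *)
Lemma bochner_functional X (f : R -> V) (v : V) :
  measurable X -> (mu X < +oo)%E -> bochner_integrable X f ->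
  is_bochner_integral X f v -> l v = \int[mu]_(s in X) l (f s).
Proof.
move=> mX X_fin jf [_ [g [sg g0 gv]]].
have [_ _ [C C0 lC]] := rl.
apply/eqP; rewrite -subr_eq0 -normr_le0; apply/ler_addgt0Pr => e e0; rewrite add0r.
have d0 : 0 < e / (2 * C) by rewrite divr_gt0// mulr_gt0.
have Ce : C * (e / (2 * C)) = e / 2.
  by rewrite invfM mulrCA [C * _]mulrCA mulfV ?mulr1// gt_eqF.
have [N1 _ h1] : \forall n \near \oo,
    (\int[mu]_(s in X) (rnorm (f s - g n s))%:E < (e / (2 * C))%:E)%E.
  move/fine_cvgP : g0 => [fin /cvgrPdist_lt/(_ _ d0)].
  apply: filterS2 fin => n fin; rewrite sub0r normrN => h.
  by rewrite -(fineK fin) lte_fin (le_lt_trans (ler_norm _)).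
have [N2 _ h2] : \forall n \near \oo, rnorm (simple_integral X (g n) - v) < e / (2 * C).
  by move/cvg_rnormP : gv; apply.
pose n := maxn N1 N2.
have {}h1 := h1 n (leq_maxl _ _); have {}h2 := h2 n (leq_maxr _ _).
have jg : bochner_integrable X (g n) by exact: bochner_integrable_simple.
have jfg := bochner_integrableB mX jf jg.
have h3 : `|l (simple_integral X (g n)) - \int[mu]_(s in X) l (f s)| <= e / 2.
  rewrite simple_integral_functional// distrC.
  apply: le_trans (functional_integral_dist mX jf jg lC) _.
  have : \int[mu]_(s in X) rnorm (f s - g n s) <= e / (2 * C).
    rewrite -lee_fin /Rintegral fineK; first exact: ltW.
    exact: integrable_fin_num jfg.2.
  move=> /(ler_wpM2l (ltW C0)) h; apply: le_trans h _.
  by rewrite Ce.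
have h4 : `|l (simple_integral X (g n)) - l v| <= e / 2.
  rewrite -real_functionalB; apply: le_trans (lC _) _.
  move: h2 => /ltW /(ler_wpM2l (ltW C0)) h; apply: le_trans h _.
  by rewrite Ce.
have := ler_distD (l (simple_integral X (g n))) (l v) (\int[mu]_(s in X) l (f s)).
rewrite (distrC (l v) (l _)); lra.
Qed.

End functional.

(** Strongly measurable functions are only pointwise limits of simple ones.
    Cutting the [n]-th simple function to 0 where its norm exceeds twice that of
    [f] keeps the pointwise convergence and makes it dominated. *)
Lemma bochner_simple_approx (V : normedModType R[i]) X (f : R -> V) :
  measurable X -> bochner_integrable X f ->
  exists2 g : nat -> R -> V, (forall n, simple_function (g n)) &
    (\int[mu]_(s in X) (rnorm (f s - g n s))%:E)%E @[n --> \oo] --> 0%E.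
Proof.
move=> mX [sf jf]; have [g sg gf] := sf.
pose A n := X `&` [set s | rnorm (g n s) <= 2 * rnorm (f s)].
have mrf := strongly_measurable_rnorm sf.
have mA n : measurable (A n).
  apply: measurable_fun_le => //.
    by apply: strongly_measurable_rnorm; exact: simple_strongly_measurable.
  by apply: measurable_funM => //; exact: measurable_cst.
pose k n s := if s \in A n then g n s else (0 : V).
have sk n : simple_function (k n).
  by apply: (@simple_if _ _ _ _ (fun=> 0)) => //; exact: simple_cst.
exists k => //.
have kf s : X s -> k n s @[n --> \oo] --> f s.
  move=> Xs; have [fs0|fs0] := eqVneq (f s) 0.
    have -> : (fun n => k n s) = cst (f s); last exact: cvg_cst.
    apply/funext => n; rewrite /k; case: ifPn => [/set_mem[_] /=|_]; last by rewrite fs0.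
    rewrite fs0 rnorm0 mulr0 => h; apply/eqP.
    by rewrite -rnorm_eq0 eq_le h rnorm_ge0.
  have nf : 0 < rnorm (f s) by rewrite lt_neqAle rnorm_ge0 eq_sym rnorm_eq0 fs0.
  have /cvg_rnormP/(_ _ nf) h := gf s Xs.
  apply/cvg_rnormP => e e0; have /cvg_rnormP/(_ _ e0) h' := gf s Xs.
  apply: filterS2 h h' => n h; rewrite /k mem_set//; split=> //=.
  by have := rnorm_le_dist (g n s) (f s); lra.
have k2 n s : X s -> rnorm (k n s) <= 2 * rnorm (f s).
  move=> Xs; rewrite /k; case: ifPn => [/set_mem[]//|_].
  by rewrite rnorm0 mulr_ge0// rnorm_ge0.
have mfk n : measurable_fun X (fun s => rnorm (f s - k n s)).
  apply: strongly_measurable_rnorm.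
  apply: (strongly_measurable_comp2 (c := fun x y => x - y)) => //.
    by move=> u v x y; exact: cvgB_seq.
  exact: simple_strongly_measurable.
have i3 : mu.-integrable X (EFin \o (fun s => 3 * rnorm (f s))).
  exact: integrable_scale.
have [|||||_ h _] := @dominated_convergence _ _ _ mu X mX
   (fun n s => (rnorm (f s - k n s))%:E) (cst 0%E) (EFin \o (fun s => 3 * rnorm (f s))).
- by move=> n; apply/measurable_EFinP; exact: mfk.
- exact: measurable_cst.
- apply: aeW => s Xs; apply/cvg_EFin; first exact: nearW.
  have /cvg_rnorm := kf s Xs; apply: cvg_trans.
  by apply: near_eq_cvg; apply: nearW => n; rewrite /= rnormB.
- exact: i3.
- apply: aeW => s n Xs; rewrite /= lee_fin ger0_norm ?rnorm_ge0//.
  have := rnormD (f s) (- k n s); rewrite rnormN; have := k2 n s Xs; lra.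
apply: cvg_trans h; apply: near_eq_cvg; apply: nearW => n /=.
by apply: eq_integral => s _; rewrite subr0 ger0_norm ?rnorm_ge0.
Qed.

Lemma is_bochner_integral_intro (V : normedModType R[i]) X (f : R -> V) (v : V) C :
  measurable X -> (mu X < +oo)%E -> bochner_integrable X f ->
  (forall g : R -> V, simple_function g ->
     rnorm (simple_integral X g - v) <= C * \int[mu]_(s in X) rnorm (f s - g s)) ->
  is_bochner_integral X f v.
Proof.
move=> mX X_fin jf vP; split; first exact: jf.1.
have [g sg g0] := bochner_simple_approx mX jf.
exists g; split=> //; apply/cvg_rnorm.
have h : C * \int[mu]_(s in X) rnorm (f s - g n s) @[n --> \oo] --> C * 0.
  apply: cvgM; first exact: cvg_cst.
  by move/fine_cvgP : g0 => [].
rewrite mulr0 in h.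
apply: (squeeze_cvgr _ (cvg_cst _) h); apply: nearW => n.
by rewrite rnorm_ge0 vP.
Qed.

Lemma rdot_functional (H : completeNormedModType R[i])
    (ip : {dot H for Num.conj}) y : norm_from_dot ip ->
  real_functional (fun x => rdot ip x y).
Proof.
move=> ipN; split; [by move=> ? ?; rewrite rdotDl|by move=> ? ?; rewrite rdotZl|].
exists (rnorm y + 1); first by rewrite ltr_wpDl ?rnorm_ge0.
move=> x; rewrite mulrC (le_trans (normr_rdot_le ipN _ _))//.
by rewrite ler_wpM2l ?rnorm_ge0// lerDl.
Qed.

Lemma rnorm_simple_integralB (H : completeNormedModType R[i])
    (ip : {dot H for Num.conj}) X (g h : R -> H) : norm_from_dot ip ->
  measurable X -> (mu X < +oo)%E -> simple_function g -> simple_function h ->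
  rnorm (simple_integral X g - simple_integral X h) <=
  \int[mu]_(s in X) rnorm (g s - h s).
Proof.
move=> ipN mX X_fin sg sh; set d := _ - _.
have jg : bochner_integrable X g by exact: bochner_integrable_simple.
have jh : bochner_integrable X h by exact: bochner_integrable_simple.
have [->|d0] := eqVneq d 0.
  by rewrite rnorm0; apply: Rintegral_ge0 => s _; exact: rnorm_ge0.
have nd : 0 < rnorm d by rewrite lt_neqAle rnorm_ge0 eq_sym rnorm_eq0 d0.
have rd := rdot_functional d ipN.
rewrite -(ler_pM2r nd) -expr2 -(rdotxx ipN) {1}/d rdotBl.
rewrite !(simple_integral_functional rd)//.
apply: le_trans (ler_norm _) _.
apply: le_trans (functional_integral_dist rd mX jg jh (C := rnorm d) _) _.
  by move=> x; rewrite mulrC; exact: normr_rdot_le.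
by rewrite mulrC.
Qed.

(** The integrals of simple approximations of [f] form a Cauchy sequence: the norm
    of the difference of two of them is its inner product with a unit vector,
    hence at most the [L^1] distance between the simple functions. *)
Theorem bochner_integral_hilbert (H : completeNormedModType R[i])
    (ip : {dot H for Num.conj}) X (f : R -> H) : norm_from_dot ip ->
  measurable X -> (mu X < +oo)%E -> bochner_integrable X f ->
  is_bochner_integral X f (bochner_integral X f).
Proof.
move=> ipN mX X_fin jf; rewrite /bochner_integral.
suff [v vP] : exists v, is_bochner_integral X f v by case: xgetP => [w ->|/(_ v)].
have [g sg g0] := bochner_simple_approx mX jf.
have jfg n : bochner_integrable X (fun s => f s - g n s).
  by apply: bochner_integrableB => //; exact: bochner_integrable_simple.
pose d n := \int[mu]_(s in X) rnorm (f s - g n s).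
have d0 : d n @[n --> \oo] --> 0 by move/fine_cvgP : g0 => [].
have gk n k : rnorm (simple_integral X (g n) - simple_integral X (g k)) <= d n + d k.
  apply: le_trans (rnorm_simple_integralB ipN mX X_fin (sg n) (sg k)) _.
  rewrite /d -RintegralD//; [|exact: (jfg n).2|exact: (jfg k).2].
  apply: le_Rintegral => //.
  - by have [] := bochner_integrableB mX (bochner_integrable_simple mX X_fin (sg n))
      (bochner_integrable_simple mX X_fin (sg k)).
  - exact: (integrable_add _ (jfg n).2 (jfg k).2).
  - by move=> s _; rewrite (rnormB (f s) (g n s)); exact: rnorm_dist.
have [v gv] : exists v : H, simple_integral X (g n) @[n --> \oo] --> v.
  apply: cauchy_rnorm => e e0.
  have /cvgrPdist_lt/(_ _ (divr_gt0 e0 (ltr0n _ 2)))[N _ NP] := d0.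
  exists N => n k Nn Nk; have := NP n Nn; have := NP k Nk.
  rewrite /= !sub0r !normrN; have := gk n k.
  have := ler_norm (d n); have := ler_norm (d k); lra.
by exists v; split; [exact: jf.1|exists g].
Qed.

Lemma normr_Re_le (z : R[i]^o) : `|complex.Re z| <= 1 * rnorm z.
Proof.
rewrite mul1r /rnorm normc_def /= -sqrtr_sqr.
by rewrite ler_wsqrtr// lerDl sqr_ge0.
Qed.

Lemma normr_Im_le (z : R[i]^o) : `|complex.Im z| <= 1 * rnorm z.
Proof.
rewrite mul1r /rnorm normc_def /= -sqrtr_sqr.
by rewrite ler_wsqrtr// lerDr sqr_ge0.
Qed.

Lemma Re_functional : real_functional (@complex.Re R : R[i]^o -> R).
Proof.
split=> [[a b] [c d]//|r [a b]/=|]; first by rewrite mul0r subr0.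
by exists 1 => //; exact: normr_Re_le.
Qed.

Lemma Im_functional : real_functional (@complex.Im R : R[i]^o -> R).
Proof.
split=> [[a b] [c d]//|r [a b]/=|]; first by rewrite mul0r addr0.
by exists 1 => //; exact: normr_Im_le.
Qed.

Lemma rnorm_le_ReIm (z : R[i]^o) : rnorm z <= `|complex.Re z| + `|complex.Im z|.
Proof.
rewrite /rnorm normc_def /=.
rewrite -(@ler_sqr R) ?nnegrE ?sqrtr_ge0 ?addr_ge0//.
rewrite sqr_sqrtr ?addr_ge0 ?sqr_ge0// sqrrD !real_normK ?num_real//.
by rewrite -addrA lerD2l lerDr mulrn_wge0// mulr_ge0.
Qed.

(** The integrals of simple approximations converge because their real and
    imaginary parts converge to known real integrals. *)
Theorem bochner_integral_complex X (f : R -> R[i]^o) :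
  measurable X -> (mu X < +oo)%E -> bochner_integrable X f ->
  bochner_integral X f =
  (\int[mu]_(s in X) complex.Re (f s)) +i* (\int[mu]_(s in X) complex.Im (f s)).
Proof.
move=> mX X_fin jf; set v : R[i]^o := _ +i* _.
have : is_bochner_integral X f (bochner_integral X f).
  rewrite /bochner_integral; suff vP : is_bochner_integral X f v.
    by case: xgetP => [w ->|/(_ v)].
  apply: (@is_bochner_integral_intro _ _ _ _ 2) => // g sg.
  have jg := bochner_integrable_simple mX X_fin sg.
  apply: le_trans (rnorm_le_ReIm _) _.
  rewrite (real_functionalB Re_functional) (real_functionalB Im_functional).
  rewrite (simple_integral_functional Re_functional)//.
  rewrite (simple_integral_functional Im_functional)// distrC [X in _ + X]distrC.
  have := functional_integral_dist Re_functional mX jf jg normr_Re_le.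
  have := functional_integral_dist Im_functional mX jf jg normr_Im_le.
  by move=> /= h1 h2; apply: le_trans (lerD h2 h1) _; rewrite !mul1r mulr_natl mulr2n.
move=> vP; apply/eqP; rewrite eq_complex /=; apply/andP; split; apply/eqP.
  exact: (bochner_functional Re_functional mX X_fin jf vP).
exact: (bochner_functional Im_functional mX X_fin jf vP).
Qed.

End bochner.

Section bochner_complements.
Context {R : realType}.
Local Notation mu := (@lebesgue_measure R).

Lemma itv_fin (a c : R) : (mu `[a, c] < +oo)%E.
Proof. by rewrite lebesgue_measure_itv /=; case: ifP => // _; rewrite ltry. Qed.

Lemma ip_bochner_integral (H : completeNormedModType R[i])
    (ip : {dot H for Num.conj}) (X : set R) (f : R -> H) y : norm_from_dot ip ->
  measurable X -> (mu X < +oo)%E -> bochner_integrable X f ->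
  ip (bochner_integral X f) y = bochner_integral X (fun s => ip (f s) y : R[i]^o).
Proof.
move=> ipN mX X_fin jf.
have jipf : bochner_integrable X (fun s => ip (f s) y : R[i]^o).
  apply: (@bochner_integrable_le _ _ _ _ (fun s => rnorm y * rnorm (f s))) => //.
  - apply: (strongly_measurable_comp (T := fun x => ip x y : R[i]^o)) jf.1.
    by move=> u x ux; apply: (cvg_ip (v := fun=> y)) => //; exact: cvg_cst.
  - exact: integrable_scale jf.2.
  - by move=> s _; rewrite mulrC; exact: rnorm_ip_le.
have fP := bochner_integral_hilbert ipN mX X_fin jf.
rewrite bochner_integral_complex// ip_rdotr; congr (_ +i* _).
  exact: (bochner_functional (rdot_functional y ipN) mX X_fin jf fP).
rewrite (bochner_functional (rdot_functional ('i *: y) ipN) mX X_fin jf fP).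
by apply: eq_Rintegral => s _; rewrite ip_rdotr.
Qed.

(** The left endpoint has measure 0, and changing a function at one point keeps it
    strongly measurable. *)
Lemma is_bochner_integral_oc (V : normedModType R[i]) (a c : R) (f g : R -> V) v :
  (forall s, a < s <= c -> f s = g s) ->
  is_bochner_integral `[a, c] f v -> is_bochner_integral `[a, c] g v.
Proof.
move=> fg [sf [h [sh h0 hv]]].
have sg : strongly_measurable `[a, c] g.
  have := @strongly_measurable_if _ _ `[a, c] `]a, c] f (fun=> g a).
  move=> /(_ (measurable_itv _)) H.
  apply: eq_strongly_measurable (H _ _) => [s /=||].
  - rewrite in_itv /= => /andP[as_ sc]; case: ifPn.
      by move=> /set_mem /=; rewrite in_itv /= => /fg.
    rewrite notin_setE /= in_itv /= sc andbT => /negP; rewrite -leNgt => sa.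
    by congr g; apply/eqP; rewrite eq_le as_ sa.
  - by apply: strongly_measurableS sf => s [].
  - exact: strongly_measurable_cst.
split=> //; exists h; split=> //.
have E n : (\int[mu]_(s in `[a, c]) (rnorm (g s - h n s))%:E =
            \int[mu]_(s in `[a, c]) (rnorm (f s - h n s))%:E)%E.
  have m (k : R -> V) : strongly_measurable `[a, c] k ->
      measurable_fun `]a, c] (fun s => (rnorm (k s - h n s))%:E).
    move=> sk; apply/measurable_EFinP.
    apply: (measurable_funS (E := `[a, c]%classic)) => //.
      by move=> s /=; rewrite !in_itv /= => /andP[/ltW -> ->].
    apply: strongly_measurable_rnorm.
    apply: (strongly_measurable_comp2 (c := fun x y => x - y)) => //.
      by move=> u w x y; exact: cvgB_seq.
    exact: simple_strongly_measurable.
  rewrite -!integral_itv_obnd_cbnd; [|exact: m|exact: m].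
  by apply: eq_integral => s /set_mem /=; rewrite in_itv /= => /fg ->.
by under eq_fun do rewrite E.
Qed.

Lemma eq_bochner_integral_oc (V : normedModType R[i]) (a c : R) (f g : R -> V) :
  (forall s, a < s <= c -> f s = g s) ->
  bochner_integral `[a, c] f = bochner_integral `[a, c] g.
Proof.
move=> fg; rewrite /bochner_integral; congr (xget 0 _); apply/seteqP; split=> v /=.
  exact: is_bochner_integral_oc.
by apply: is_bochner_integral_oc => s /fg.
Qed.

Lemma Rintegral_itv_split (a c d : R) (f : R -> R) : a <= c -> c <= d ->
  mu.-integrable `[a, d] (EFin \o f) ->
  \int[mu]_(s in `[a, d]) f s =
  \int[mu]_(s in `[a, c]) f s + \int[mu]_(s in `[c, d]) f s.
Proof.
move=> ac cd jf; have := @Rintegral_itvB _ f (BLeft a) (BRight d) c jf.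
rewrite !bnd_simp => /(_ ac cd) /eqP.
rewrite subr_eq addrC => /eqP ->; congr (_ + _).
rewrite Rintegral_itv_obnd_cbnd//; apply: integrableS jf => //.
by move=> s /=; rewrite !in_itv /= => /andP[/ltW cs ->]; rewrite (le_trans ac cs).
Qed.

Lemma bochner_complex_split (a c d : R) (f : R -> R[i]^o) : a <= c -> c <= d ->
  bochner_integrable `[a, d] f ->
  bochner_integral `[a, d] f = bochner_integral `[a, c] f + bochner_integral `[c, d] f.
Proof.
move=> ac cd jf.
have jf1 : bochner_integrable `[a, c] f.
  apply: bochner_integrableS jf => //.
  by move=> s /=; rewrite !in_itv /= => /andP[-> sc]; exact: le_trans cd.
have jf2 : bochner_integrable `[c, d] f.
  apply: bochner_integrableS jf => //.
  by move=> s /=; rewrite !in_itv /= => /andP[cs ->]; rewrite (le_trans ac).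
rewrite !bochner_integral_complex//; try exact: itv_fin.
rewrite (Rintegral_itv_split ac cd); last exact: (real_functional_integrable Re_functional).
by rewrite (Rintegral_itv_split ac cd)//; exact: (real_functional_integrable Im_functional).
Qed.

Lemma bochner_complex_subdivision (t : nat -> R) n (f : R -> R[i]^o) :
  (forall k, (k < n)%N -> t k <= t k.+1) ->
  bochner_integrable `[t 0%N, t n] f ->
  bochner_integral `[t 0%N, t n] f = \sum_(k < n) bochner_integral `[t k, t k.+1] f.
Proof.
elim: n => [|n IH] tn jf.
  rewrite big_ord0 bochner_integral_complex//; last exact: itv_fin.
  by rewrite set_itv1 !Rintegral_set1.
have t0n : t 0%N <= t n.
  elim: n tn {IH jf} => // n IH tn; apply: (@le_trans _ _ (t n)); last exact: tn.
  by apply: IH => k kn; apply: tn; exact: ltnW.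
rewrite big_ord_recr /= -IH; first exact: (bochner_complex_split t0n (tn n (ltnSn n)) jf).
  by move=> k kn; apply: tn; exact: ltnW.
apply: bochner_integrableS jf => //.
move=> s /=; rewrite !in_itv /= => /andP[-> sn].
exact: le_trans sn (tn n (ltnSn n)).
Qed.

End bochner_complements.

(** * Strongly continuous families of operators *)

Section strongly_continuous_family.
Context {R : realType} {H Y : completeNormedModType R[i]}.
Variables (ipH : {dot H for Num.conj}) (ipY : {dot Y for Num.conj}).
Hypotheses (ipHN : norm_from_dot ipH) (ipYN : norm_from_dot ipY).
Hypothesis sepH : separable_space H.
Variables (a c : R) (V : R -> H -> H).
Hypothesis ac : a <= c.
Hypothesis bV : forall s, a <= s <= c -> bounded_linear (V s).
Hypothesis cV : forall x s, a <= s <= c ->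
  V r x @[r --> within `[a, c] (nbhs s)] --> V s x.
Variable B : Y -> H.
Hypothesis bB : bounded_linear B.
Local Notation mu := (@lebesgue_measure R).

Lemma family_rdot_continuous x y :
  {within `[a, c], continuous (fun s => rdot ipH (V s x) y)}.
Proof.
apply/subspace_continuousP => s; rewrite /= in_itv /= => /(@cV x s) /cvg_rnormP h.
apply/cvgrPdist_lt => e e0.
have N0 : 0 < rnorm y + 1 by rewrite ltr_wpDl ?rnorm_ge0.
have := h _ (divr_gt0 e0 N0); apply: filterS => r hr.
rewrite distrC -rdotBl; apply: le_lt_trans (normr_rdot_le ipHN _ _) _.
apply: le_lt_trans (_ : rnorm (V r x - V s x) * (rnorm y + 1) < e).
  by rewrite ler_wpM2l ?rnorm_ge0// lerDl.
by rewrite -ltr_pdivlMr.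
Qed.

(** The orbit of each vector is continuous on a compact interval, hence bounded. *)
Lemma family_bounded :
  exists2 M : R, 0 < M & forall s, a <= s <= c -> forall x, rnorm (V s x) <= M * rnorm x.
Proof.
have [_ [s sac ->]|x|M M0 MP] :=
    @uniform_boundedness R H H [set T | exists2 s, a <= s <= c & T = V s].
- exact: bV.
- have cx : {within `[a, c], continuous (fun s => rnorm (V s x))}.
    apply/subspace_continuousP => s; rewrite /= in_itv /= => /(@cV x s) /cvg_rnormP h.
    apply/cvgrPdist_lt => e e0; have := h _ e0; apply: filterS => r.
    have := rnorm_le_dist (V r x) (V s x); have := rnorm_le_dist (V s x) (V r x).
    rewrite (rnormB (V s x)) ltr_norml; lra.
  have [r _ rP] := EVT_max ac cx; exists (rnorm (V r x)) => _ [s sac ->].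
  by apply: rP; rewrite in_itv.
by exists M => // s sac; apply: MP; exists s.
Qed.

(** The adjoints of a strongly continuous family need not be strongly continuous;
    they are weakly continuous, and separability does the rest. *)
Lemma family_adjoint_strongly_measurable y :
  strongly_measurable `[a, c] (fun s => adjoint ipH ipH (V s) y).
Proof.
apply: (pettis_measurability ipHN) => // z.
apply: (eq_measurable_fun (fun s => rdot ipH (V s z) y)) => [s|].
  by move=> /set_mem /=; rewrite in_itv /= => sac; rewrite [RHS]rdotC /rdot -(adjointE ipHN ipHN (bV sac)).
apply: subspace_continuous_measurable_fun => //.
exact: family_rdot_continuous.
Qed.

(** Tested against [z], the function becomes the inner product of [u] with
    [B^* V^* z], and both factors are strongly measurable. *)
Lemma family_control_strongly_measurable (u : R -> Y) :
  strongly_measurable `[a, c] u ->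
  strongly_measurable `[a, c] (fun s => V s (B (u s))).
Proof.
move=> su; apply: (pettis_measurability ipHN) => // z.
have bBadj : strongly_measurable `[a, c]
    (fun s => adjoint ipY ipH B (adjoint ipH ipH (V s) z)).
  apply: (strongly_measurable_comp (T := adjoint ipY ipH B)); last first.
    exact: family_adjoint_strongly_measurable.
  by move=> w z0; apply: bounded_linear_cvg; exact: adjoint_bounded_linear.
have sip := strongly_measurable_comp2 (fun u v x y => @cvg_ip R Y ipY u v x y ipYN) su bBadj.
apply: (eq_measurable_fun (fun s => complex.Re (ipY (u s)
    (adjoint ipY ipH B (adjoint ipH ipH (V s) z))))) => [s|].
  move=> /set_mem /=; rewrite in_itv /= => sac.
  by rewrite /rdot (adjointE ipHN ipHN (bV sac)) (adjointE ipYN ipHN bB).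
exact: (real_functional_measurable Re_functional sip).
Qed.

Lemma family_adjoint_bounded y : exists M : R, forall s, a <= s <= c ->
  rnorm (adjoint ipY ipH B (adjoint ipH ipH (V s) y)) <= M.
Proof.
have [M M0 MP] := family_bounded.
have [_ [N N0 NP]] := (bounded_linearP B).1 bB.
exists (N * (M * rnorm y)) => s sac.
apply: le_trans (rnorm_adjoint_le ipYN ipHN bB (ltW N0) NP _) _.
rewrite ler_pM2l//; apply: (rnorm_adjoint_le ipHN ipHN (bV sac) (ltW M0)).
exact: MP.
Qed.

Lemma family_control_integrable (u : R -> Y) :
  strongly_measurable `[a, c] u ->
  mu.-integrable `[a, c] (EFin \o (fun s => rnorm (u s) ^+ 2)) ->
  bochner_integrable `[a, c] (fun s => V s (B (u s))).
Proof.
move=> su ju; have [M M0 MP] := family_bounded.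
have [_ [N N0 NP]] := (bounded_linearP B).1 bB.
apply: (@bochner_integrable_le _ _ _ _ (fun s => M * N * (1 + rnorm (u s) ^+ 2))) => //.
- exact: family_control_strongly_measurable.
- apply: integrable_scale => //; apply: integrable_add => //.
  by apply: integrable_cst => //; exact: itv_fin.
- (* on a bounded interval, [r <= 1 + r ^+ 2] reduces integrability to square
     integrability *)
  move=> s /=; rewrite in_itv /= => sac.
  apply: le_trans (MP _ sac _) _; rewrite -mulrA ler_pM2l//.
  apply: le_trans (NP _) _; rewrite ler_pM2l//.
  have := sqr_ge0 (rnorm (u s) - 1); nra.
Qed.

Lemma family_ip_bochner (u : R -> Y) y :
  strongly_measurable `[a, c] u ->
  mu.-integrable `[a, c] (EFin \o (fun s => rnorm (u s) ^+ 2)) ->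
  ipH (bochner_integral `[a, c] (fun s => V s (B (u s)))) y =
  bochner_integral `[a, c] (fun s =>
    ipY (u s) (adjoint ipY ipH B (adjoint ipH ipH (V s) y)) : R[i]^o).
Proof.
move=> su ju.
have jVBu := family_control_integrable su ju.
rewrite (ip_bochner_integral y ipHN (measurable_itv `[a, c]) (itv_fin a c) jVBu).
apply: (@eq_bochner_integral_oc _ R[i]^o) => s /andP[/ltW as_ sc].
have sac : a <= s <= c by rewrite as_.
by rewrite (adjointE ipHN ipHN (bV sac)) (adjointE ipYN ipHN bB).
Qed.

End strongly_continuous_family.

(** * The space of controls *)

Section control_space.
Context {R : realType} {Y : completeNormedModType R[i]}.
Variable ip : {dot Y for Num.conj}.
Hypothesis ipN : norm_from_dot ip.
Variables (b : R) (m : nat).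
Local Notation mu := (@lebesgue_measure R).
Implicit Types w : (R -> Y) * ('I_m -> Y).

Lemma L2P (u : R -> Y) : L2 b u <-> strongly_measurable `[0, b] u /\
  mu.-integrable `[0, b] (EFin \o (fun s => rnorm (u s) ^+ 2)).
Proof.
have E : (\int[mu]_(s in `[0%R, b]) `|(EFin \o (fun s => (rnorm (u s) ^+ 2)%R)) s| =
    \int[mu]_(s in `[0%R, b]) (rnorm (u s) ^+ 2)%:E)%E.
  by apply: eq_integral => s _; rewrite /= ger0_norm// sqr_ge0.
split=> -[su ju]; split=> //.
  apply/integrableP; split; last by rewrite E.
  apply/measurable_EFinP; apply: measurable_funX.
  exact: strongly_measurable_rnorm.
by move/integrableP: ju => [_]; rewrite E.
Qed.

Lemma L2_of_bounded (u : R -> Y) M : strongly_measurable `[0, b] u ->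
  (forall s, 0 <= s <= b -> rnorm (u s) <= M) -> L2 b u.
Proof.
move=> su uM; apply/L2P; split=> //.
apply: (@integrable_le _ _ _ (fun=> M ^+ 2)) => //.
- by apply: measurable_funX; exact: strongly_measurable_rnorm.
- by apply: integrable_cst => //; exact: itv_fin.
- move=> s /=; rewrite in_itv /= => sb; rewrite ger0_norm ?sqr_ge0//.
  by rewrite lerXn2r ?nnegrE ?rnorm_ge0 ?uM// (le_trans (rnorm_ge0 (u s)))// uM.
Qed.

Lemma L2_ip_integrable (u v : R -> Y) : L2 b u -> L2 b v ->
  bochner_integrable `[0, b] (fun s => ip (u s) (v s) : R[i]^o).
Proof.
move=> /L2P[su ju] /L2P[sv jv].
apply: (@bochner_integrable_le _ _ _ _ (fun s => rnorm (u s) ^+ 2 + rnorm (v s) ^+ 2)) => //.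
- apply: (strongly_measurable_comp2 (c := fun x y => ip x y : R[i]^o)) => //.
  by move=> x y p q; exact: cvg_ip.
- exact: integrable_add.
- move=> s _; apply: le_trans (rnorm_ip_le ipN _ _) _.
  have := sqr_ge0 (rnorm (u s) - rnorm (v s)).
  have := sqr_ge0 (rnorm (u s)); have := sqr_ge0 (rnorm (v s)); nra.
Qed.

Lemma control_dotE w w' : L2 b w.1 -> L2 b w'.1 ->
  control_dot ip b w w' =
  (\int[mu]_(s in `[0, b]) complex.Re (ip (w.1 s) (w'.1 s))) +i*
  (\int[mu]_(s in `[0, b]) complex.Im (ip (w.1 s) (w'.1 s))) +
  \sum_(k < m) ip (w.2 k) (w'.2 k).
Proof.
move=> w2 w2'; rewrite /control_dot bochner_integral_complex//; first exact: itv_fin.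
exact: L2_ip_integrable.
Qed.

Lemma control_dot_conj w w' : L2 b w.1 -> L2 b w'.1 ->
  control_dot ip b w' w = Num.conj (control_dot ip b w w').
Proof.
move=> w2 w2'; rewrite !control_dotE// rmorphD rmorph_sum /=; congr (_ + _); last first.
  by apply: eq_bigr => k _; exact: ip_conj.
have j := L2_ip_integrable w2 w2'.
have -> z : Num.conj z = (z : R[i])^*%C by [].
rewrite /=; congr (_ +i* _).
  by apply: eq_Rintegral => s _; rewrite (ip_conj ip (w.1 s)); case: (ip _ _).
rewrite -mulN1r -RintegralZl//; last exact: (real_functional_integrable Im_functional _ j).
by apply: eq_Rintegral => s _; rewrite mulN1r (ip_conj ip (w.1 s)); case: (ip _ _).
Qed.

Lemma Re_control_dot w : L2 b w.1 -> complex.Re (control_dot ip b w w) =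
  \int[mu]_(s in `[0, b]) rnorm (w.1 s) ^+ 2 + \sum_(k < m) rnorm (w.2 k) ^+ 2.
Proof.
move=> w2; rewrite control_dotE// (raddfD (@complex.Re R)) raddf_sum /=; congr (_ + _).
  by apply: eq_Rintegral => s _; exact: (rdotxx ipN).
by apply: eq_bigr => k _; exact: (rdotxx ipN).
Qed.

Lemma control_dot_ge0 w : L2 b w.1 -> 0 <= complex.Re (control_dot ip b w w).
Proof.
move=> w2; rewrite Re_control_dot// addr_ge0//; last by apply: sumr_ge0 => k _; exact: sqr_ge0.
by apply: Rintegral_ge0 => s _; exact: sqr_ge0.
Qed.

Lemma control_dot_definite w : L2 b w.1 -> complex.Re (control_dot ip b w w) = 0 ->
  null_control b w.
Proof.
move=> w2; rewrite Re_control_dot// => /eqP; rewrite paddr_eq0; last 2 first.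
- by apply: Rintegral_ge0 => s _; exact: sqr_ge0.
- by apply: sumr_ge0 => k _; exact: sqr_ge0.
move=> /andP[/eqP i0]; rewrite psumr_eq0; last by move=> k _; exact: sqr_ge0.
move=> /allP s0; split; last first.
  move=> k; have := s0 k (mem_index_enum _); rewrite /= sqrf_eq0 rnorm_eq0.
  by move/eqP.
have /L2P[su ju] := w2.
have i0' : (\int[mu]_(s in `[0%R, b]) `|(EFin \o (fun s => (rnorm (w.1 s) ^+ 2)%R)) s| = 0)%E.
  have -> : (\int[mu]_(s in `[0%R, b]) `|(EFin \o (fun s => (rnorm (w.1 s) ^+ 2)%R)) s| =
      \int[mu]_(s in `[0%R, b]) (EFin \o (fun s => (rnorm (w.1 s) ^+ 2)%R)) s)%E.
    by apply: eq_integral => s _; rewrite /= ger0_norm// sqr_ge0.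
  rewrite -[LHS]fineK ?[X in X%:E]i0//; exact: (integrable_fin_num _ ju).
have mf : measurable_fun `[0, b] (EFin \o (fun s => rnorm (w.1 s) ^+ 2)).
  by case/integrableP : ju.
have h := (ae_eq_integral_abs mu (measurable_itv `[0, b]) mf).1 i0'.
apply: filterS h => s hs sb.
have := hs sb; rewrite /= => -[/eqP].
by rewrite sqrf_eq0 rnorm_eq0 => /eqP.
Qed.

Lemma control_dot_null w w' : L2 b w.1 -> L2 b w'.1 -> null_control b w ->
  control_dot ip b w' w = 0.
Proof.
move=> w2 w2' [w10 w20]; rewrite control_dotE//.
have i0 (l : R[i]^o -> R) : real_functional l ->
    \int[mu]_(s in `[0, b]) l (ip (w'.1 s) (w.1 s)) = 0.
  move=> rl; have jl := real_functional_integrable rl (measurable_itv _) (L2_ip_integrable w2' w2).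
  rewrite /Rintegral (@ae_eq_integral _ _ _ mu _ (cst 0%E)) ?integral0//.
  - by case/integrableP : jl.
  - case: w10 => N [mN N0 wN]; exists N; split=> //; apply: subset_trans wN => s.
    apply: contra_not => ws sb; rewrite /= (ws sb).
    by rewrite linear0 (real_functional0 rl).
rewrite (i0 _ Re_functional) (i0 _ Im_functional) big1 ?addr0// => k _.
by rewrite w20 linear0.
Qed.

End control_space.

Section piecewise.
Context {R : realType} {T : Type}.
Variables (t : nat -> R) (F : nat -> R -> T).

(** Each breakpoint belongs to the interval that ends there, so that the pieces
    are prescribed on the half-open intervals open at the left. *)
Fixpoint piecewise (n : nat) (s : R) : T :=
  if n is k.+1 then if s <= t n then piecewise k s else F n s else F 0%N s.

Lemma subdivision_le n i j : (forall k, (k < n)%N -> t k <= t k.+1) ->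
  (i <= j <= n)%N -> t i <= t j.
Proof.
move=> tn /andP[ij jn]; elim: j ij jn => [|j IH]; first by rewrite leqn0 => /eqP ->.
rewrite leq_eqVlt => /predU1P[->//|ij] jn.
by apply: le_trans (tn j jn); apply: IH => //; exact: ltnW.
Qed.

Lemma piecewiseE n k s : (forall j, (j < n.+1)%N -> t j <= t j.+1) -> (k <= n)%N ->
  t k < s <= t k.+1 -> piecewise n s = F k s.
Proof.
elim: n => [|n IH] tn; first by rewrite leqn0 => /eqP ->.
move=> kn /andP[ks sk] /=; have [sn|ns] := leP s (t n.+1).
  move: kn; rewrite leq_eqVlt => /predU1P[kE|kn].
    by move: ks; rewrite kE ltNge sn.
  by apply: IH => //; [move=> j jn; apply: tn; exact: ltnW|exact/andP].
move: kn; rewrite leq_eqVlt => /predU1P[-> //|kn].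
have : t k.+1 <= t n.+1 by apply: (subdivision_le tn); rewrite kn /=.
by move=> /(le_trans sk); rewrite leNgt ns.
Qed.

Lemma piecewise_cases n s : t 0%N <= s <= t n.+1 ->
  exists2 k, (k <= n)%N & t k <= s <= t k.+1 /\ piecewise n s = F k s.
Proof.
elim: n => [|n IH] sn; first by exists 0%N.
have [h|h] := leP s (t n.+1); last first.
  exists n.+1 => //; split; first by rewrite (ltW h); case/andP: sn.
  by rewrite /= leNgt h.
have [k kn [ks pE]] := IH (ltac:(by rewrite h; case/andP: sn => ->)).
by exists k; [exact: leqW|split=> //=; rewrite h].
Qed.

End piecewise.

Lemma piecewise_strongly_measurable (R : realType) (V : normedModType R[i])
    (t : nat -> R) (F : nat -> R -> V) n :
  (forall k, (k <= n)%N -> strongly_measurable `[t k, t k.+1] (F k)) ->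
  strongly_measurable `[t 0%N, t n.+1] (piecewise t F n).
Proof.
elim: n => [|n IH] sF; first exact: sF.
have -> : piecewise t F n.+1 = fun s =>
    if s \in `]-oo, t n.+1]%classic then piecewise t F n s else F n.+1 s.
  apply/funext => s /=; congr (if _ then _ else _).
  apply/idP/idP => [h|/set_mem]; last by rewrite /= in_itv.
  by apply/mem_set; rewrite /= in_itv.
apply: strongly_measurable_if => //.
- have IHn : strongly_measurable `[t 0%N, t n.+1] (piecewise t F n).
    by apply: IH => k kn; apply: sF; exact: leqW.
  by apply: strongly_measurableS IHn => s [] /=; rewrite !in_itv /= => /andP[-> _].
- apply: strongly_measurableS (sF n.+1 (leqnn _)) => s [] /=.
  by rewrite !in_itv /= => /andP[_ ->] /negP; rewrite -ltNge => /ltW ->.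
Qed.

Lemma piecewise_bounded (R : realType) (V : normedModType R[i])
    (t : nat -> R) (F : nat -> R -> V) n :
  (forall k, (k <= n)%N -> exists M : R, forall s, t k <= s <= t k.+1 -> rnorm (F k s) <= M) ->
  exists M : R, forall s, t 0%N <= s <= t n.+1 -> rnorm (piecewise t F n s) <= M.
Proof.
move=> bF; have /choice[M MP] k : exists M : R, (k <= n)%N ->
    forall s, t k <= s <= t k.+1 -> rnorm (F k s) <= M.
  have [kn|_] := leqP k n; last by exists 0.
  by have [M MP] := bF k kn; exists M.
exists (\sum_(k < n.+1) `|M k|) => s /piecewise_cases - /(_ _ F)[k kn [ks ->]].
apply: le_trans (MP k kn s ks) _; apply: le_trans (ler_norm _) _.
by rewrite (bigD1 (Ordinal (kn : (k < n.+1)%N)))//= lerDl sumr_ge0.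
Qed.

(** * The control operator and its Gramian *)

Lemma evolution_family_continuous (R : realType) (V : normedModType R[i]) (b : R)
    (A : R -> linop V) (U : R -> R -> V -> V) (a c : R) : evolution_family b A U ->
  0 <= a -> c <= b -> forall x s, a <= s <= c ->
  U c r x @[r --> within `[a, c] (nbhs s)] --> U c s x.
Proof.
move=> [_ _ _ cU _] a0 cb x s /andP[as_ sc]; apply/cvg_rnormP => e e0.
have /subspace_continuousP/(_ (c, s)) := cU x.
have cs : [/\ 0 <= s, s <= c & c <= b] by rewrite (le_trans a0).
move=> /(_ cs) /cvg_rnormP/(_ e e0).
rewrite /within /= => Ue.
have cc : (fun r : R => (c, r)) @ nbhs s --> (c, s).
  exact: (@cvg_pair _ _ _ (nbhs s) (nbhs c) (nbhs s) _ _ _ (fun=> c) id (cvg_cst c) cvg_id).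
suff : \forall r \near s, `[a, c]%classic r -> rnorm (U c r x - U c s x) < e by [].
have h : \forall r \near s,
  [/\ 0 <= r, r <= c & c <= b] -> rnorm (U c r x - U c s x) < e := cc _ Ue.
apply: filterS h => r h rac; apply: h => /=.
by move: rac; rewrite /= in_itv /= => /andP[ar rc]; split=> //; exact: le_trans ar.
Qed.

Lemma downward_ind (P : nat -> Prop) n : P n.+1 ->
  (forall i, (1 <= i <= n)%N -> P i.+1 -> P i) ->
  forall i, (1 <= i <= n.+1)%N -> P i.
Proof.
move=> Pn PS i /andP[i1 ile]; rewrite -(subKn ile).
have : (n.+1 - i <= n)%N by rewrite leq_subLR -add1n leq_add2r.
elim: (n.+1 - i)%N => [|k IH kn]; first by rewrite subn0.
apply: PS; first by rewrite subn_gt0 ltnS kn subSS leq_subr.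
by rewrite subnSK; [apply: IH; exact: ltnW|exact: ltnW].
Qed.

Section impulsive_system.
Context {R : realType} {H Y : completeNormedModType R[i]}.
Variables (ipH : {dot H for Num.conj}) (ipY : {dot Y for Num.conj}).
Hypotheses (hilbertH : norm_from_dot ipH) (hilbertY : norm_from_dot ipY).
Hypothesis sepH : separable_space H.
Variables (b : R) (m : nat) (t : nat -> R).
Hypotheses (m_gt0 : (0 < m)%N) (t_0 : t 0%N = 0) (t_last : t m.+1 = b).
Hypothesis t_incr : forall k, (k <= m)%N -> t k < t k.+1.
Variables (A : R -> linop H) (U : R -> R -> H -> H).
Hypothesis hU : evolution_family b A U.
Variables (B : Y -> H) (D : nat -> H -> H) (E : nat -> Y -> H).
Hypothesis hB : bounded_linear B.
Hypothesis hD : forall k, (1 <= k <= m)%N -> bounded_linear (D k).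
Hypothesis hE : forall k, (1 <= k <= m)%N -> bounded_linear (E k).
Local Notation mu := (@lebesgue_measure R).
Local Notation M := (control_operator (m := m) b t U B D E).
Local Notation W := (gramian ipH ipY b m t U B D E).

Let t_le i j : (i <= j <= m.+1)%N -> t i <= t j.
Proof. by apply: subdivision_le => k km; apply/ltW/t_incr. Qed.

Let t_ge0 i : (i <= m.+1)%N -> 0 <= t i.
Proof. by move=> im; rewrite -t_0; exact: t_le. Qed.

Let t_leb i : (i <= m.+1)%N -> t i <= b.
Proof. by move=> im; rewrite -t_last; apply: t_le; rewrite im /=. Qed.

Let bU i s : (i <= m.+1)%N -> 0 <= s <= t i -> bounded_linear (U (t i) s).
Proof. by move=> im /andP[s0 si]; case: hU => h _ _ _ _; apply: h => //; exact: t_leb. Qed.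

Let bUtm : bounded_linear (U b (t m)).
Proof. by rewrite -t_last; apply: bU => //; rewrite t_ge0//= ltW// t_incr. Qed.

Let bUt j : (1 <= j <= m)%N -> bounded_linear (U (t j) (t j.-1)).
Proof.
case: j => // j /= jm; apply: bU; first exact: leqW.
by rewrite t_ge0 ?(leq_trans (ltnW jm))//= ltW// t_incr// ltnW.
Qed.

Lemma ip_jump j x y : (1 <= j <= m)%N ->
  ipH (jump t U D j x) y = ipH x (jump_adj ipH t U D j y).
Proof.
move=> jm; rewrite /jump /jump_adj -(adjointE hilbertH hilbertH (bUt jm)).
by rewrite ipDl ipDr -(adjointE hilbertH hilbertH (hD jm)).
Qed.

Lemma prod_descS (F : nat -> H -> H) k i x : (i <= k)%N ->
  prod_desc F k i x = prod_desc F k i.+1 (F i x).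
Proof. by move=> ik; rewrite /prod_desc big_ltn. Qed.

Lemma prod_ascS (F : nat -> H -> H) k i x : (i <= k)%N ->
  prod_asc F i k x = F i (prod_asc F i.+1 k x).
Proof. by move=> ik; rewrite /prod_asc big_ltn. Qed.

Lemma ip_prod_jump i x y : (1 <= i <= m.+1)%N ->
  ipH (prod_desc (jump t U D) m i x) y = ipH x (prod_asc (jump_adj ipH t U D) i m y).
Proof.
move=> im; move: i im x; apply: downward_ind => [x|i im IH x].
  by rewrite /prod_desc /prod_asc !big_geq.
have /andP[_ im'] := im.
by rewrite prod_descS// prod_ascS// IH ip_jump.
Qed.

(** The vector that pairs with the response at time [t k.+1] to the control
    acting on the [k]-th interval, when the final state is tested against
    [phi]: it is propagated backwards from [phi] through the adjoints of the
    jumps. *)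
Definition costate (phi : H) (k : nat) : H :=
  if (k < m)%N then
    let y := prod_asc (jump_adj ipH t U D) k.+2 m (adjoint ipH ipH (U b (t m)) phi) in
    y + adjoint ipH ipH (D k.+1) y
  else phi.

Definition adjoint_control (phi : H) : (R -> Y) * ('I_m -> Y) :=
  (piecewise t (fun k s =>
     adjoint ipY ipH B (adjoint ipH ipH (U (t k.+1) s) (costate phi k))) m,
   fun k : 'I_m => adjoint ipY ipH (E k.+1)
     (prod_asc (jump_adj ipH t U D) k.+2 m (adjoint ipH ipH (U b (t m)) phi))).

Let bUk k s : (k <= m)%N -> t k <= s <= t k.+1 -> bounded_linear (U (t k.+1) s).
Proof.
move=> km /andP[ks sk]; apply: bU => //.
by rewrite sk andbT (le_trans _ ks)// t_ge0// leqW.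
Qed.

Let cUk k x s : (k <= m)%N -> t k <= s <= t k.+1 ->
  U (t k.+1) r x @[r --> within `[t k, t k.+1] (nbhs s)] --> U (t k.+1) s x.
Proof.
move=> km; apply: (evolution_family_continuous hU).
  by apply: t_ge0; exact: leqW.
exact: t_leb.
Qed.

Let tk k : (k <= m)%N -> t k <= t k.+1.
Proof. by move=> km; exact/ltW/t_incr. Qed.

(** Each piece is strongly measurable and bounded on its interval. *)
Lemma adjoint_control_L2 phi : L2 b (adjoint_control phi).1.
Proof.
have sm : strongly_measurable `[0, b] (adjoint_control phi).1.
  rewrite -t_0 -t_last; apply: piecewise_strongly_measurable => k km.
  apply: (strongly_measurable_comp (T := adjoint ipY ipH B)).
    move=> u x; apply: bounded_linear_cvg.
    exact: (adjoint_bounded_linear hilbertY hilbertH hB).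
  apply: family_adjoint_strongly_measurable => //.
  - by move=> s; exact: bUk.
  - by move=> x s; exact: cUk.
have [N NP] : exists N : R, forall s, t 0%N <= s <= t m.+1 ->
    rnorm ((adjoint_control phi).1 s) <= N.
  apply: piecewise_bounded => k km.
  apply: (family_adjoint_bounded hilbertH hilbertY (tk km) _ _ hB).
  - by move=> s; exact: bUk.
  - by move=> x s; exact: cUk.
by apply: (L2_of_bounded sm (M := N)) => s; rewrite -{1}t_0 -{1}t_last => /NP.
Qed.

Lemma adjoint_control1E phi k s : (k <= m)%N -> t k < s <= t k.+1 ->
  (adjoint_control phi).1 s =
  adjoint ipY ipH B (adjoint ipH ipH (U (t k.+1) s) (costate phi k)).
Proof.
by move=> km; apply: piecewiseE => // j jm; exact: tk.
Qed.

Let L2_piece (u : R -> Y) k : (k <= m)%N -> L2 b u ->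
  strongly_measurable `[t k, t k.+1] u /\
  mu.-integrable `[t k, t k.+1] (EFin \o (fun s => rnorm (u s) ^+ 2)).
Proof.
move=> km /L2P[su ju].
have sub : `[t k, t k.+1]%classic `<=` `[0, b]%classic.
  move=> s /=; rewrite !in_itv /= => /andP[ks sk].
  by rewrite (le_trans _ ks) ?t_ge0 ?(le_trans sk) ?t_leb// leqW.
split; first exact: strongly_measurableS su.
exact: integrableS ju.
Qed.

(** The state reached at time [t k.+1] from the state 0 at time [t k]. *)
Definition response (u : R -> Y) (k : nat) : H :=
  bochner_integral `[t k, t k.+1] (fun s => U (t k.+1) s (B (u s))).

Lemma ip_response phi u k : (k <= m)%N -> L2 b u ->
  ipH (response u k) (costate phi k) =
  bochner_integral `[t k, t k.+1]
    (fun s => ipY (u s) ((adjoint_control phi).1 s) : R[i]^o).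
Proof.
move=> km u2; have [su ju] := L2_piece km u2.
rewrite /response (family_ip_bochner hilbertH hilbertY sepH (tk km)
  (fun s => @bUk k s km) (fun x s => @cUk k x s km) hB (costate phi k) su ju).
apply: (@eq_bochner_integral_oc _ R[i]^o) => s sk.
by rewrite (adjoint_control1E phi km sk).
Qed.

Lemma ctrlE (v : 'I_m -> Y) (k : 'I_m) : ctrl v k.+1 = v k.
Proof. by rewrite /ctrl /= insubT //= => km; congr v; exact: val_inj. Qed.

(** Each term of [M w] is a product of operators applied to a response or to an
    impulse. Moving these operators to the other side turns [phi] into the
    costates, and the integrals over the intervals add up to one over
    [[0, b]]. *)
Theorem ip_control_operator phi w : L2 b w.1 ->
  ipH (M w) phi = control_dot ipY b w (adjoint_control phi).
Proof.
move=> w2; set psi := adjoint ipH ipH (U b (t m)) phi.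
have Upsi x : ipH (U b (t m) x) phi = ipH x psi.
  exact: (adjointE hilbertH hilbertH bUtm).
have ip0l y : ipH 0 y = 0 by rewrite -(scale0r (0 : H)) ipZl mul0r.
have ip_sum (I : Type) (r : seq I) P (F : I -> H) y :
    ipH (\sum_(i <- r | P i) F i) y = \sum_(i <- r | P i) ipH (F i) y.
  by apply: (big_morph (fun x => ipH x y)) => // x z; exact: ipDl.
rewrite /control_operator 3!ipDl 3!Upsi 2!ip_sum.
have -> : control_dot ipY b w (adjoint_control phi) =
    \sum_(k < m.+1) ipH (response w.1 k) (costate phi k) +
    \sum_(k < m) ipY (w.2 k) ((adjoint_control phi).2 k).
  rewrite /control_dot; congr (_ + _).
  rewrite -t_0 -t_last bochner_complex_subdivision.
  - by apply: eq_bigr => k _; rewrite ip_response// -ltnS.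
  - by move=> k km; apply: tk; rewrite -ltnS.
  - by rewrite t_0 t_last; exact: (L2_ip_integrable hilbertY w2 (adjoint_control_L2 phi)).
rewrite big_ord_recr /= -addrA; congr (_ + _ + _).
- rewrite big_add1 big_mkord; apply: eq_bigr => k _.
  rewrite ip_prod_jump ?ltnS//= /response /costate ltn_ord.
  rewrite ipDr ipDl -(adjointE hilbertH hilbertH (hD _)) ?ltn_ord//.
- by rewrite /response /costate ltnn t_last.
(* the impulse at [t m] is the term of index [m.+1] of the sum, with an empty
   product *)
pose F i := ipH (E i.-1 (ctrl w.2 i.-1)) (prod_asc (jump_adj ipH t U D) i m psi).
have -> : ipH (E m (ctrl w.2 m)) psi = F m.+1.
  by rewrite /F /prod_asc big_geq.
rewrite (eq_big_nat _ _ (F2 := F)); last first.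
  by move=> i /andP[i2 im]; rewrite ip_prod_jump// (ltnW i2) ltnW.
rewrite -big_nat_recr//= 2!big_add1 big_mkord; apply: eq_bigr => k _.
by rewrite /F /= ctrlE (adjointE hilbertY hilbertH (hE _)) ?ltn_ord.
Qed.

(** The integrands of the two sides agree except at left endpoints. *)
Theorem control_operator_adjoint_control phi : M (adjoint_control phi) = W phi.
Proof.
set psi := adjoint ipH ipH (U b (t m)) phi.
have addE (x x' y y' : H) : x = x' -> y = y' -> x + y = x' + y' by move=> -> ->.
rewrite /control_operator /gramian; apply: (addE); [apply: (addE); [apply: (addE)|]|].
- rewrite /Theta; apply: (f_equal (U b (t m))); apply: eq_big_nat => i /andP[i1 im].
  apply: (f_equal (prod_desc (jump t U D) m i.+1)).
  set z1 := bochner_integral _ _; set z2 := bochner_integral _ _.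
  suff -> : z1 = z2 by [].
  apply: eq_bochner_integral_oc; case: i i1 im @z1 @z2 => [|k] i1 km z1 z2 s sk; first by [].
  have {}km : (k < m)%N by exact: km.
  by rewrite (adjoint_control1E phi (ltnW km) sk) /costate km.
- rewrite /Gamma; apply: eq_bochner_integral_oc => s sk.
  rewrite -t_last in sk.
  by rewrite (adjoint_control1E phi (leqnn m) sk) /costate ltnn t_last.
- rewrite /Theta_tilde; apply: (f_equal (U b (t m))); apply: eq_big_nat => i.
  case: i => [|[|k]] /andP[i2 im]; first by [].
    by [].
  have km : (k < m)%N by exact: ltnW.
  by rewrite (ctrlE _ (Ordinal km)).
- have lm : (m.-1 < m)%N by rewrite prednK.
  have ctrlm (v : 'I_m -> Y) : ctrl v m = v (Ordinal lm).
    by rewrite -(ctrlE v (Ordinal lm)) /= prednK.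
  rewrite /Gamma_tilde ctrlm; apply: (f_equal (U b (t m))).
  rewrite [LHS]/= -/psi prednK//; apply: (f_equal (E m)).
  by rewrite /prod_asc big_geq.
Qed.

Lemma ip_gramian phi psi : ipH (W phi) psi =
  control_dot ipY b (adjoint_control phi) (adjoint_control psi).
Proof.
rewrite -control_operator_adjoint_control ip_control_operator//.
exact: adjoint_control_L2.
Qed.

Lemma gramian_symmetric phi psi : ipH (W phi) psi = ipH phi (W psi).
Proof.
rewrite (ip_conj ipH (W psi)) !ip_gramian.
by apply: control_dot_conj => //; exact: adjoint_control_L2.
Qed.

Lemma gramian_ge0 phi : 0 <= rdot ipH (W phi) phi.
Proof. by rewrite /rdot ip_gramian control_dot_ge0//; exact: adjoint_control_L2. Qed.

Lemma control_adjointP phi :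
  L2 b (control_adjoint ipH ipY b M phi).1 /\
  forall w, L2 b w.1 ->
    ipH (M w) phi = control_dot ipY b w (control_adjoint ipH ipY b M phi).
Proof.
rewrite /control_adjoint; case: xgetP => [w -> []//|/(_ (adjoint_control phi))[]].
split; first exact: adjoint_control_L2.
by move=> w w2; exact: ip_control_operator.
Qed.

(** A control that is orthogonal to every control is orthogonal to itself, hence
    null. *)
Lemma control_adjoint_null phi : null_control b (control_adjoint ipH ipY b M phi) <->
  forall w, L2 b w.1 -> ipH (M w) phi = 0.
Proof.
have [a2 aE] := control_adjointP phi; split=> [a0 w w2|M0].
  by rewrite aE//; exact: control_dot_null.
by apply: (control_dot_definite hilbertY a2); rewrite -aE// M0.
Qed.

(** The quadratic form of the Gramian at [phi] is the squared norm of
    [adjoint_control phi], which represents [ipH (M w) phi] as a function of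
    [w]. *)
Lemma gramian_kernel phi : rdot ipH (W phi) phi = 0 ->
  forall w, L2 b w.1 -> ipH (M w) phi = 0.
Proof.
rewrite /rdot ip_gramian => /(control_dot_definite hilbertY (adjoint_control_L2 phi)).
move=> G0 w w2; rewrite ip_control_operator//.
by apply: control_dot_null => //; exact: adjoint_control_L2.
Qed.

Lemma gramian_range phi : [set M w | w in [set w | L2 b w.1]] (W phi).
Proof.
exists (adjoint_control phi); first exact: adjoint_control_L2.
exact: control_operator_adjoint_control.
Qed.

End impulsive_system.

Unset Implicit Arguments.

Theorem theorem2p1 (R : realType)
    (H Y : completeNormedModType R[i])
    (ipH : {dot H for Num.conj}) (ipY : {dot Y for Num.conj})
    (hilbertH : norm_from_dot ipH) (hilbertY : norm_from_dot ipY)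
    (sepH : separable_space H)
    (b : R) (b_gt0 : 0 < b)
    (m : nat) (m_gt0 : (0 < m)%N)
    (t : nat -> R) (t_0 : t 0%N = 0) (t_last : t m.+1 = b)
    (t_incr : forall k, (k <= m)%N -> t k < t k.+1)
    (A : R -> linop H)
    (hR1 : condR1 b A) (hR2 : condR2 b A)
    (hR3 : condR3 b A) (hR4 : condR4 b A)
    (U : R -> R -> H -> H) (hU : evolution_family b A U)
    (B : Y -> H) (hB : bounded_linear B)
    (D : nat -> H -> H)
    (hD : forall k, (1 <= k <= m)%N -> bounded_linear (D k))
    (E : nat -> Y -> H)
    (hE : forall k, (1 <= k <= m)%N -> bounded_linear (E k)) :
  let M := control_operator (m := m) b t U B D E in
  let W := gramian ipH ipY b m t U B D E in
  [<-> approximately_controllable b M;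
       forall phi : H, null_control b (control_adjoint ipH ipY b M phi) ->
         phi = 0;
       strictly_positive ipH W;
       shift_invertible W /\ cvg0_strong (scaled_inverse W);
       shift_invertible W /\ cvg0_weak ipH (scaled_inverse W)].
Proof.
move=> M W.
have Wsym x y : ipH (W x) y = ipH x (W y).
  exact: (gramian_symmetric hilbertH hilbertY sepH m_gt0 t_0 t_last t_incr hU hB hD hE).
have Wb : bounded_linear W by exact: (symmetric_bounded_linear hilbertH Wsym).
have nullP := control_adjoint_null
  hilbertH hilbertY sepH m_gt0 t_0 t_last t_incr hU hB hD hE.
tfae.
- move=> Mdense phi /nullP phi0.
  apply/eqP; rewrite -rnorm_eq0 -sqrf_eq0 -(rdotxx hilbertH); apply/eqP.
  have Mphi s : (M @` [set w | L2 b w.1]) s -> ipH phi s = 0.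
    by move=> [w w2 <-]; rewrite ip_conj (phi0 _ w2) rmorph0.
  rewrite /rdot (closure_orthogonal hilbertH Mphi)//.
  by move: Mdense; rewrite /approximately_controllable => ->.
- move=> Minj; split=> // x x0; rewrite (symmetric_form_real x Wsym) ltcR.
  have W0 := gramian_ge0 hilbertH hilbertY sepH m_gt0 t_0 t_last t_incr hU hB hD hE x.
  rewrite lt_neqAle W0 andbT eq_sym; apply: contraNneq x0 => Wxx.
  apply/eqP/Minj/nullP.
  exact: (gramian_kernel hilbertH hilbertY sepH m_gt0 t_0 t_last t_incr hU hB hD hE Wxx).
- exact: strictly_positive_cvg0_strong.
- by move=> [Winv W0]; split=> //; exact: cvg0_strong_weak.
- move=> [Winv W0]; apply/seteqP; split=> // x _.
  have : closure (range W) x by rewrite (cvg0_weak_dense_range hilbertH Wb Winv W0).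
  apply: closure_subset => _ [phi _ <-].
  exact: (gramian_range hilbertH hilbertY sepH m_gt0 t_0 t_last t_incr hU).
Qed.
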